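(* Let $r\geq 0$ and $s,t$ be integers, and write $E_{2}^{r}E_{4}^{s}E_{6}^{t}=\sum_{n} a(n)q^{n}$. If $\ell$ is a prime for which $E_{2}^{r}E_{4}^{s}E_{6}^{t}$ has a simple congruence $a(\ell n+c)\equiv 0 \pmod{\ell}$ (that is, there is an integer $c$ such that $a(\ell n+c)\equiv 0\pmod{\ell}$ for all integers $n$), then either $\ell \leq 2r+8|s|+12|t|+21$ or $r=s=t=0$.
   Context: Let $\sigma_m(n)=\sum_{d\mid n}d^m$ and define the Bernoulli numbers $B_k$ by $\frac{t}{e^t-1}=\sum_{k=0}^\infty B_k\frac{t^k}{k!}$. For even $k\geq 2$ set $E_k = 1-\frac{2k}{B_k}\sum_{n=1}^{\infty}\sigma_{k-1}(n)q^n$, regarded as a power series in $q$. Thus $E_2=1-24\sum_{n\ge1}\sigma_1(n)q^n$, $E_4=1+240\sum_{n\ge1}\sigma_3(n)q^n$, $E_6=1-504\sum_{n\ge1}\sigma_5(n)q^n$. These have integer coefficients and constant term $1$, so they are invertible in $\mathbb{Z}[[q]]$, and $E_2^rE_4^sE_6^t\in\mathbb{Z}[[q]]$ also for negative exponents. Coefficients $a(n)$ with $n<0$ are taken to be $0$. *)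

(* Defs.v *)
From HB Require Import structures.
From mathcomp Require Import all_boot all_order all_algebra.
From mathcomp Require Import boolp ring.

Set Implicit Arguments.
Unset Strict Implicit.
Unset Printing Implicit Defensive.

Import Order.TTheory GRing.Theory Num.Theory.
Local Open Scope ring_scope.

(* The ring R[[q]], as a commutative unit ring, so that the library's
   operations, and integer powers [f ^ s] with [s : int], are available. *)
Record fps (R : Type) := Fps { fps_coef :> nat -> R }.

Lemma fpsP (R : Type) (f g : fps R) : f =1 g <-> f = g.
Proof. by case: f g => f [g]; split=> [/funext /= ->|->]. Qed.

HB.instance Definition _ (R : Type) := gen_eqMixin (fps R).
HB.instance Definition _ (R : Type) := gen_choiceMixin (fps R).

Definition fps_add (R : zmodType) (f g : fps R) := Fps (fun n => f n + g n).
Definition fps_opp (R : zmodType) (f : fps R) := Fps (fun n => - f n).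
Definition fps_zero (R : zmodType) : fps R := Fps (fun=> 0).

Lemma fps_addA (R : zmodType) : associative (@fps_add R).
Proof. by move=> f g h; apply/fpsP => n /=; rewrite addrA. Qed.

Lemma fps_addC (R : zmodType) : commutative (@fps_add R).
Proof. by move=> f g; apply/fpsP => n /=; rewrite addrC. Qed.

Lemma fps_add0 (R : zmodType) : left_id (@fps_zero R) (@fps_add R).
Proof. by move=> f; apply/fpsP => n /=; rewrite add0r. Qed.

Lemma fps_addN (R : zmodType) :
  left_inverse (@fps_zero R) (@fps_opp R) (@fps_add R).
Proof. by move=> f; apply/fpsP => n /=; rewrite addNr. Qed.

HB.instance Definition _ (R : zmodType) := GRing.isZmodule.Build (fps R)
  (@fps_addA R) (@fps_addC R) (@fps_add0 R) (@fps_addN R).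

Definition fps_one (R : comNzRingType) : fps R := Fps (fun n => (n == 0%N)%:R).

Definition fps_mul (R : comNzRingType) (f g : fps R) : fps R :=
  Fps (fun n => \sum_(i < n.+1) f i * g (n - i)%N).

Definition fps_trunc (R : comNzRingType) (N : nat) (f : fps R) : {poly R} :=
  \poly_(i < N) f i.

Lemma coef_fps_trunc (R : comNzRingType) N (f : fps R) n :
  (n < N)%N -> (fps_trunc N f)`_n = f n.
Proof. by move=> ltnN; rewrite coef_poly ltnN. Qed.

Lemma fps_mul_trunc (R : comNzRingType) N (f g : fps R) n : (n < N)%N ->
  fps_mul f g n = (fps_trunc N f * fps_trunc N g)`_n.
Proof.
move=> ltnN; rewrite coefM; apply: eq_bigr => i _.
rewrite !coef_fps_trunc //; first exact: leq_ltn_trans (leq_subr _ _) ltnN.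
by apply: leq_ltn_trans ltnN; rewrite -ltnS.
Qed.

Lemma fps_mulC (R : comNzRingType) : commutative (@fps_mul R).
Proof.
by move=> f g; apply/fpsP => n; rewrite !(@fps_mul_trunc _ n.+1) // mulrC.
Qed.

Lemma fps_mulA (R : comNzRingType) : associative (@fps_mul R).
Proof.
move=> f g h; apply/fpsP => n.
transitivity ((fps_trunc n.+1 f * (fps_trunc n.+1 g * fps_trunc n.+1 h))`_n).
  rewrite coefM; apply: eq_bigr => i _; rewrite coef_fps_trunc //.
  by rewrite (@fps_mul_trunc _ n.+1) // ltnS leq_subr.
rewrite mulrA coefM; apply: eq_bigr => i _.
by rewrite -fps_mul_trunc ?coef_fps_trunc // ltnS leq_subr.
Qed.

Lemma fps_mul1 (R : comNzRingType) : left_id (@fps_one R) (@fps_mul R).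
Proof.
move=> f; apply/fpsP => n /=; rewrite big_ord_recl subn0 mul1r big1 ?addr0 //.
by move=> i _; rewrite mul0r.
Qed.

Lemma fps_mulDl (R : comNzRingType) :
  left_distributive (@fps_mul R) (@fps_add R).
Proof.
move=> f g h; apply/fpsP => n /=; rewrite -big_split.
by apply: eq_bigr => i _; rewrite mulrDl.
Qed.

Lemma fps_one_neq0 (R : comNzRingType) : @fps_one R != 0.
Proof.
apply/eqP => /fpsP /(_ 0%N) /= e10.
by have /eqP := oner_neq0 R.
Qed.

HB.instance Definition _ (R : comNzRingType) :=
  GRing.Zmodule_isComNzRing.Build (fps R) (@fps_mulA R) (@fps_mulC R)
    (@fps_mul1 R) (@fps_mulDl R) (@fps_one_neq0 R).

Lemma coef_fpsD (R : zmodType) (f g : fps R) n : (f + g) n = f n + g n.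
Proof. by []. Qed.

Lemma coef_fpsN (R : zmodType) (f : fps R) n : (- f) n = - f n.
Proof. by []. Qed.

Lemma coef_fps1 (R : comNzRingType) n : (1 : fps R) n = (n == 0%N)%:R.
Proof. by []. Qed.

Lemma coef_fpsM (R : comNzRingType) (f g : fps R) n :
  (f * g) n = \sum_(i < n.+1) f i * g (n - i)%N.
Proof. by []. Qed.

Definition fps_unit (R : comUnitRingType) : {pred fps R} :=
  fun f => f 0%N \is a GRing.unit.

(* The first [n] coefficients of the inverse [g] of [f], from the equations
   \sum_(i < m.+1) f (m - i) * g i = (m == 0)%:R solved for [g m]. *)
Fixpoint fps_inv_seq (R : comUnitRingType) (f : fps R) (n : nat) : seq R :=
  if n is m.+1 then
    let s := fps_inv_seq f m in
    rcons s ((f 0%N)^-1 * ((m == 0%N)%:R - \sum_(i < m) f (m - i)%N * s`_i))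
  else [::].

(* Following the library's convention, inversion is the identity outside the
   units. *)
Definition fps_inv (R : comUnitRingType) (f : fps R) : fps R :=
  if f \in @fps_unit R then Fps (fun n => (fps_inv_seq f n.+1)`_n) else f.

Lemma size_fps_inv_seq (R : comUnitRingType) (f : fps R) n :
  size (fps_inv_seq f n) = n.
Proof. by elim: n => //= n IHn; rewrite size_rcons IHn. Qed.

Lemma nth_fps_inv_seq (R : comUnitRingType) (f : fps R) n i : (i < n)%N ->
  (fps_inv_seq f n)`_i = (fps_inv_seq f i.+1)`_i.
Proof.
elim: n => // n IHn; rewrite ltnS leq_eqVlt => /predU1P[-> //|ltin].
by rewrite -(IHn ltin) [LHS]nth_rcons size_fps_inv_seq ltin.
Qed.

Lemma fps_inv_rec (R : comUnitRingType) (f : fps R) n : f \in @fps_unit R ->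
  fps_inv f n =
  (f 0%N)^-1 * ((n == 0%N)%:R - \sum_(i < n) f (n - i)%N * fps_inv f i).
Proof.
move=> fu; rewrite /fps_inv fu /= nth_rcons size_fps_inv_seq ltnn eqxx.
congr (_ * (_ - _)); apply: eq_bigr => i _; congr (_ * _).
exact: nth_fps_inv_seq (ltn_ord i).
Qed.

Lemma fps_mulVx (R : comUnitRingType) :
  {in @fps_unit R, left_inverse 1 (@fps_inv R) *%R}.
Proof.
move=> f fu; apply/fpsP => n; rewrite coef_fpsM coef_fps1 big_ord_recr /=.
rewrite subnn fps_inv_rec // mulrAC mulVr // mul1r.
rewrite (eq_bigr (fun i : 'I_n => f (n - i)%N * fps_inv f i)) => [|i _].
  by rewrite addrC subrK.
by rewrite mulrC.
Qed.

Lemma fps_unitPl (R : comUnitRingType) (f g : fps R) :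
  g * f = 1 -> @fps_unit R f.
Proof.
move=> /fpsP /(_ 0%N); rewrite coef_fpsM big_ord1 subn0 coef_fps1 eqxx => gf1.
by apply/unitrPr; exists (g 0%N); rewrite mulrC.
Qed.

Lemma fps_inv_out (R : comUnitRingType) :
  {in [predC @fps_unit R], @fps_inv R =1 id}.
Proof. by move=> f /negbTE fu; rewrite /fps_inv fu. Qed.

HB.instance Definition _ (R : comUnitRingType) :=
  GRing.ComNzRing_hasMulInverse.Build (fps R)
    (@fps_mulVx R) (@fps_unitPl R) (@fps_inv_out R).

Definition fpsX (R : comNzRingType) : fps R := Fps (fun n => (n == 1%N)%:R).

Definition fps_exp : fps rat := Fps (fun n => (n`!%:R)^-1).

(* [Fps (fun n => fps_exp n.+1)] is (e^t - 1) / t; see [bernoulliP]. *)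
Definition bernoulli (k : nat) : rat :=
  k`!%:R * (Fps (fun n => fps_exp n.+1))^-1 k.

Lemma bernoulliP :
  (fps_exp - 1) * Fps (fun k => bernoulli k / k`!%:R) = fpsX rat.
Proof.
set g := Fps (fun n => fps_exp n.+1).
have gu : g \is a GRing.unit by rewrite unfold_in /= /fps_unit /= invr1 unitr1.
have -> : Fps (fun k => bernoulli k / k`!%:R) = g^-1.
  apply/fpsP => k; rewrite [LHS]mulrC mulKf //.
  by rewrite pnatr_eq0 -lt0n fact_gt0.
have -> : fps_exp - 1 = fpsX rat * g.
  apply/fpsP => n; rewrite coef_fpsD coef_fpsN coef_fps1 coef_fpsM.
  rewrite big_ord_recl /= mul0r add0r; case: n => [|n].
    by rewrite big_ord0 invr1 subrr.
  rewrite big_ord_recl /= mul1r big1 ?addr0 ?subr0 //.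
    by rewrite subSS subn0.
  by move=> i _; rewrite mul0r.
by rewrite -mulrA mulrV ?mulr1.
Qed.

Definition sigma (m n : nat) : nat := (\sum_(d <- divisors n) d ^ m)%N.

Definition eisenstein (k : nat) : fps rat :=
  Fps (fun n => if n == 0%N then 1
                else - ((2 * k)%N%:R / bernoulli k) * (sigma k.-1 n)%:R).

(* The integral power series equal to [eisenstein 2], [eisenstein 4] and
   [eisenstein 6]; see [E2_eisenstein], [E4_eisenstein], [E6_eisenstein]. *)
Definition E2 : fps int :=
  Fps (fun n => if n == 0%N then 1 else - 24 * (sigma 1 n)%:Z).
Definition E4 : fps int :=
  Fps (fun n => if n == 0%N then 1 else 240 * (sigma 3 n)%:Z).
Definition E6 : fps int :=
  Fps (fun n => if n == 0%N then 1 else - 504 * (sigma 5 n)%:Z).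

Lemma bernoulli_rec246 (F : numFieldType) (g h : nat -> F) :
    g 0%N = 1 -> (forall n, g n.+1 = g n / n.+2%:R) ->
    (forall n, h n = (n == 0%N)%:R - \sum_(0 <= i < n) g (n - i)%N * h i) ->
  [/\ h 2 = 12^-1, h 4 = - 720^-1 & h 6 = 720^-1 / 42].
Proof.
move=> g0 gS rec.
have g1 : g 1%N = 2^-1 by rewrite gS g0 mul1r.
have g2 : g 2%N = 2^-1 / 3 by rewrite gS g1.
have g3 : g 3%N = 2^-1 / 3 / 4 by rewrite gS g2.
have g4 : g 4%N = 2^-1 / 3 / 4 / 5 by rewrite gS g3.
have g5 : g 5%N = 2^-1 / 3 / 4 / 5 / 6 by rewrite gS g4.
have g6 : g 6%N = 2^-1 / 3 / 4 / 5 / 6 / 7 by rewrite gS g5.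
have h0 : h 0%N = 1 by rewrite rec big_geq // subr0.
have h1 : h 1%N = - 2^-1.
  by rewrite rec !big_nat_recr // big_geq //= h0 g1; field.
have h2 : h 2%N = 12^-1.
  by rewrite rec !big_nat_recr // big_geq //= h0 h1 g1 g2; field.
have h3 : h 3%N = 0.
  by rewrite rec !big_nat_recr // big_geq //= h0 h1 h2 g1 g2 g3; field.
have h4 : h 4%N = - 720^-1.
  rewrite rec !big_nat_recr // big_geq //= h0 h1 h2 h3 g1 g2 g3 g4.
  by field.
have h5 : h 5%N = 0.
  rewrite rec !big_nat_recr // big_geq //= h0 h1 h2 h3 h4 g1 g2 g3 g4 g5.
  by field.
split=> //; rewrite rec !big_nat_recr // big_geq //= h0 h1 h2 h3 h4 h5.
by rewrite g1 g2 g3 g4 g5 g6; field.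
Qed.

Lemma bernoulli246 :
  [/\ bernoulli 2 = 6^-1, bernoulli 4 = - 30^-1 & bernoulli 6 = 42^-1].
Proof.
rewrite /bernoulli; set g := Fps _.
have g0 : g 0%N = 1 by exact: invr1.
have gS n : g n.+1 = g n / n.+2%:R by rewrite mulrC -invfM -natrM -factS.
have gu : g \in @fps_unit rat by rewrite unfold_in /fps_unit g0 unitr1.
have rec n : g^-1 n = (n == 0%N)%:R - \sum_(0 <= i < n) g (n - i)%N * g^-1 i.
  by rewrite big_mkord [LHS](fps_inv_rec n gu) g0 invr1 mul1r.
have [-> -> ->] := bernoulli_rec246 g0 gS rec.
by rewrite !factS fact0 !natrM; split; field.
Qed.

Lemma eisenstein_int (k : nat) (c : int) :
  c%:~R = - ((2 * k)%N%:R / bernoulli k) -> forall n,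
  (if n == 0%N then 1 else c * (sigma k.-1 n)%:Z)%:~R = eisenstein k n.
Proof.
move=> cE n.
have -> : eisenstein k n =
  if n == 0%N then 1 else - ((2 * k)%N%:R / bernoulli k) * (sigma k.-1 n)%:R.
  by [].
by rewrite -cE; case: eqP => // _; rewrite intrM.
Qed.

Lemma E2_eisenstein n : (E2 n)%:~R = eisenstein 2 n.
Proof.
apply: (@eisenstein_int 2 (- 24) _ n); have [-> _ _] := bernoulli246.
by rewrite invrK rmorphN rmorph_nat -natrM; congr (- _%:R).
Qed.

Lemma E4_eisenstein n : (E4 n)%:~R = eisenstein 4 n.
Proof.
apply: (@eisenstein_int 4 (240) _ n); have [_ -> _] := bernoulli246.
by rewrite invrN invrK mulrN opprK rmorph_nat -natrM; congr (_%:R).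
Qed.

Lemma E6_eisenstein n : (E6 n)%:~R = eisenstein 6 n.
Proof.
apply: (@eisenstein_int 6 (- 504) _ n); have [_ _ ->] := bernoulli246.
by rewrite invrK rmorphN rmorph_nat -natrM; congr (- _%:R).
Qed.

Lemma E246_unit :
  [/\ E2 \is a GRing.unit, E4 \is a GRing.unit & E6 \is a GRing.unit].
Proof. by []. Qed.

Definition coefz (f : fps int) (n : int) : int := if n is Posz m then f m else 0.

Definition simple_congruence (f : fps int) (l : nat) : Prop :=
  exists c : int, forall n : int,
    (coefz f (l%:Z * n + c)%R = 0 %[mod l%:Z])%Z.

(* Main.v *)
Require Import Defs.
From HB Require Import structures.
From mathcomp Require Import all_boot all_order all_algebra.
From mathcomp Require Import boolp closed_field ring zify.
Set Implicit Arguments.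
Unset Strict Implicit.
Unset Printing Implicit Defensive.
Import Order.TTheory GRing.Theory Num.Theory.
Local Open Scope ring_scope.

(** Let l = 2n + 1 be a prime above the bound, K an algebraic closure of the field
    with l elements and theta = q d/dq; the hypothesis is exploited entirely
    through differential equations over K.

    A coefficient is multiplied by its index under theta, so a simple congruence
    in the class of c, which is not 0 because a(0) = 1, is the relation
    sum_(1 <= j < l) c^(-j) theta^j F = 0 ([congruence_theta]).  Powers of E4^l and
    E6^l are constants for theta, so multiplying by them makes s and t
    nonnegative without losing the relation.

    Put nu = E6 / E4 and xi = E4^3 / E6^2, so that E4 = xi nu^2, E6 = xi nu^3,
    and a modular form of weight 2i is g(xi) nu^i for a polynomial g.
    Ramanujan's equations, which are proved from Liouville's elementary
    convolution identities ([ramanujan_ode]), become equations for nu and xi.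
    Computing theta^l xi = theta xi with them shows that a power of 1 / nu is a
    polynomial in xi ([hasse_sq_q]): this plays the role of the congruence
    E_(l-1) = 1 and produces the square of the Hasse invariant.  Its logarithmic
    derivative is E2, whose Riccati equation turns into a second order equation
    ([hasse_ode0]).  The local exponents of that equation give a square root a,
    the Hasse invariant, with a(xi) nu^n = 1, simple zeros away from 0, and known
    orders at 0 and at infinity ([hasse_sqrt], [hasse_roots]).  In particular
    E2 is congruent to a form of weight l + 1, so each theta^j F is G_j(xi) nu^i
    with an explicit polynomial G_j and an explicit weight.

    Since 1 / nu is an n-th root of a(xi) and a has a simple zero, its first n
    powers are independent over K[xi] ([root_independent]).  Hence the relation
    above splits according to the weight modulo l - 1, and one of the pieces reads
    G_(n+1) = c' a^(n+1) G_1 with a nonzero constant c' ([weight_separation]).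

    At a zero z of a, theta acts on a form of weight 2i that vanishes to order v
    by preserving the order unless 2i + v = 0 mod l ([wtheta_order]).  Let
    k = r + 4s + 6t be the weight of F; then G_j has weight k + j mod l, and G_0
    does not vanish at z because E2 does not.  If k > 0, the order stays 0 up to
    G_(n+1), which contradicts the factor a^(n+1).  If k <= 0, the order can only
    change on the way to G_(1-k), so G_(1-k) vanishes to order n + 1 at z.
    For k = 0 this says that theta F vanishes at every zero of a, an affine
    equation in z which has at least two solutions, so that its coefficients
    vanish and r = s = t = 0.  For k < 0 the form G_(1-k) is nonzero and vanishes to
    order n + 1 at about n / 6 points, more than its weight allows
    ([supp_count]). *)

(** * Products of Lambert series *)

Section Lambert.
Variables (R : comNzRingType) (M : nat).

Lemma sum_above N (F : nat -> nat -> R) :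
  \sum_(1 <= k < N) \sum_(k.+1 <= m < N) F k m =
  \sum_(1 <= m < N) \sum_(1 <= k < m) F k m.
Proof.
elim: N => [|[|N] IH]; try by rewrite !big_geq.
rewrite [RHS]big_nat_recr //= -IH [LHS]big_nat_recr //= [X in _ + X]big_geq //.
rewrite addr0 -big_split /=; apply: eq_big_nat => k /andP[k1 kN].
by rewrite big_nat_recr.
Qed.

Lemma sum_antidiag (h : nat -> nat -> R) :
    (forall m n, (M <= m + n)%N -> h m n = 0) ->
  \sum_(1 <= m < M) \sum_(1 <= n < M) h m n =
  \sum_(1 <= N < M) \sum_(1 <= m < N) h m (N - m)%N.
Proof.
move=> h0; rewrite -sum_above; apply: eq_big_nat => m /andP[m1 mM].
rewrite -(add1n m) big_addn (big_nat_widen _ _ M) ?leq_subr //= [RHS]big_mkcond /=.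
by apply: eq_bigr => n _; rewrite addnK; case: ifP => // nM; apply: h0; lia.
Qed.

Lemma sum_offdiag (h : nat -> nat -> R) :
    (forall m n, (M <= n)%N -> h m n = 0) ->
  \sum_(1 <= k < M) \sum_(1 <= m < M) h m (m + k)%N =
  \sum_(1 <= n < M) \sum_(1 <= m < n) h m n.
Proof.
move=> h0; rewrite exchange_big sum_antidiag => [|m n mn]; last exact: h0.
apply: eq_bigr => N _; apply: eq_big_nat => m /andP[_ mN].
by rewrite subnKC // ltnW.
Qed.

Lemma sum_sym (h : nat -> nat -> R) : (forall m n, h m n = h n m) ->
  \sum_(1 <= m < M) \sum_(1 <= n < M) h m n =
  2 * (\sum_(1 <= n < M) \sum_(1 <= m < n) h m n) + \sum_(1 <= m < M) h m m.
Proof.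
move=> hC; elim: M => [|[|N] IH]; try by rewrite !big_geq // mulr0 addr0.
rewrite !(@big_nat_recr _ _ _ N.+1) //=.
under eq_bigr => m _ do rewrite (@big_nat_recr _ _ _ N.+1) //=.
rewrite big_split /= IH.
have -> : \sum_(1 <= m < N.+1) h N.+1 m = \sum_(1 <= m < N.+1) h m N.+1.
  by apply: eq_bigr => m _.
ring.
Qed.

(* The model for l n is q^n / (1 - q^n) modulo q^M; truncating makes all sums
   finite. *)
Variable l : nat -> R.
Hypothesis l_ge : forall n, (M <= n)%N -> l n = 0.
Hypothesis l_mul : forall m n, (0 < m)%N -> (0 < n)%N ->
  l m * l n = l (m + n)%N * (1 + l m + l n).

(** By the product rule l (m + n) factors out of l m * l n, and only one
    variable is left in the remaining factor. *)
Lemma lambert_sum (f : nat -> R) (w : nat -> nat -> R) :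
    (forall m n, w m n = w n m) ->
  \sum_(1 <= m < M) \sum_(1 <= n < M) f (m + n)%N * w m n * (l m * l n) =
  \sum_(1 <= N < M) f N * l N *
    (\sum_(1 <= m < N) w m (N - m)%N + 2 * \sum_(1 <= m < N) w m (N - m)%N * l m).
Proof.
move=> wC.
transitivity (\sum_(1 <= m < M) \sum_(1 <= n < M)
    f (m + n)%N * l (m + n)%N * (w m n * (1 + l m + l n))).
  apply: eq_big_nat => m /andP[m0 _].
  apply: eq_big_nat => n /andP[n0 _].
  rewrite l_mul //; ring.
rewrite sum_antidiag => [|m n mn]; last by rewrite l_ge // mulr0 mul0r.
apply: eq_big_nat => N /andP[N0 NM].
transitivity (\sum_(1 <= m < N) f N * l N *
   (w m (N - m)%N + w m (N - m)%N * l m + w m (N - m)%N * l (N - m)%N)).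
  apply: eq_big_nat => m /andP[m0 mN].
  rewrite subnKC; [ring | exact: ltnW].
rewrite -mulr_sumr !big_split /=; congr (_ * _).
have -> : \sum_(1 <= m < N) w m (N - m)%N * l (N - m)%N =
          \sum_(1 <= m < N) w m (N - m)%N * l m.
  rewrite big_nat_rev /=; apply: eq_big_nat => m /andP[m0 mN].
  by rewrite (_ : 1 + N - m.+1 = N - m)%N 1?wC ?subKn //; lia.
ring.
Qed.

Lemma lambert_shift (u : nat -> R) k :
  \sum_(1 <= m < M) u m * l (m + k)%N = \sum_(k.+1 <= m < M) u (m - k)%N * l m.
Proof.
rewrite -(add1n k) big_addn.
rewrite (big_nat_widen 1 (M - k) M) ?leq_subr //= [RHS]big_mkcond /=.
apply: eq_bigr => m _; rewrite addnK; case: ifP => // mM.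
by rewrite l_ge ?mulr0 //; lia.
Qed.

(** For the indices m and k the product rule also expresses l m * l (m + k)
    through l k * l m, l k * l (m + k) and l (m + k): a product over a fixed
    difference k becomes linear once l k is factored out. *)
Lemma lambert_diff (w : nat -> nat -> R) k : (0 < k)%N ->
  \sum_(1 <= m < M) w m (m + k)%N * (l m * l (m + k)%N) =
  l k * (\sum_(1 <= m < M) w m (m + k)%N * l m
         - \sum_(k.+1 <= m < M) w (m - k)%N m * l m)
  - \sum_(k.+1 <= m < M) w (m - k)%N m * l m.
Proof.
move=> k0.
have <- : \sum_(1 <= m < M) w m (m + k)%N * l (m + k)%N =
          \sum_(k.+1 <= m < M) w (m - k)%N m * l m.
  rewrite lambert_shift; apply: eq_big_nat => m /andP[km _].
  by rewrite subnK // ltnW.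
rewrite -sumrB mulr_sumr -sumrB; apply: eq_big_nat => m /andP[m0 _].
have := l_mul m0 k0 => lmk.
have -> : l m * l (m + k)%N = l m * l k - l (m + k)%N - l k * l (m + k)%N.
  rewrite lmk; ring.
ring.
Qed.

Lemma lambert_above (F : nat -> R) (w : nat -> nat -> R) :
  \sum_(1 <= k < M) F k * (\sum_(k.+1 <= m < M) w k m * l m) =
  \sum_(1 <= N < M) l N * \sum_(1 <= k < N) F k * w k N.
Proof.
under eq_bigr => k _ do rewrite mulr_sumr.
rewrite sum_above; apply: eq_bigr => N _; rewrite mulr_sumr.
by apply: eq_bigr => k _; ring.
Qed.

Lemma sum_split_at k (F : nat -> R) : (0 < k < M)%N ->
  \sum_(1 <= m < M) F m =
  \sum_(1 <= m < k) F m + F k + \sum_(k.+1 <= m < M) F m.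
Proof.
case/andP=> k0 kM; rewrite (big_cat_nat (n := k.+1)) //=.
by congr (_ + _); rewrite big_nat_recr.
Qed.

(** Liouville's device: the products l m * l n are summed over the lines m + n
    = N and over the lines |m - n| = k. Both sums contain f N * l N * l m over
    all m < N with the coefficient 2, so in the difference only the diagonal
    squares remain quadratic. *)
Lemma liouville1 (f : nat -> R) :
  \sum_(1 <= m < M) \sum_(1 <= n < M) f (m + n)%N * (l m * l n)
  - 2 * \sum_(1 <= k < M) f k * \sum_(1 <= m < M) l m * l (m + k)%N =
  \sum_(1 <= N < M)
     (l N * (f N * (N%:R - 1) + 2 * \sum_(1 <= k < N) f k) - 2 * (f N * l N ^+ 2)).
Proof.
have := @lambert_sum f (fun _ _ => 1) (fun _ _ => erefl).
under eq_bigr => m _ do under eq_bigr => n _ do rewrite mulr1.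
move=> ->.
have -> : \sum_(1 <= k < M) f k * \sum_(1 <= m < M) l m * l (m + k)%N =
  \sum_(1 <= k < M) f k * (l k * (\sum_(1 <= m < k) l m + l k)) -
  \sum_(1 <= N < M) l N * \sum_(1 <= k < N) f k * 1.
  have <- := lambert_above f (fun _ _ => 1).
  rewrite -sumrB; apply: eq_big_nat => k kM; rewrite -mulrBr; congr (_ * _).
  have := @lambert_diff (fun _ _ => 1) k; case/andP: (kM) => -> _ /(_ isT).
  under eq_bigr => m _ do rewrite mul1r.
  move=> ->; congr (l k * _ - _); rewrite (sum_split_at _ kM) addrK.
  by under eq_bigr => m _ do rewrite mul1r; rewrite mul1r.
rewrite -sumrB mulr_sumr -sumrB; apply: eq_big_nat => N /andP[N1 NM].
have -> : \sum_(1 <= m < N) 1 * l m = \sum_(1 <= m < N) l m.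
  by apply: eq_bigr => m _; rewrite mul1r.
have -> : \sum_(1 <= k < N) f k * 1 = \sum_(1 <= k < N) f k.
  by apply: eq_bigr => k _; rewrite mulr1.
rewrite sumr_const_nat natrB //; ring.
Qed.

(** With the weight m * n the quadratic terms of the two families cancel in
    the sum rather than in the difference, except for one product of two
    single sums. *)
Lemma liouville2 (f : nat -> R) :
  \sum_(1 <= m < M) \sum_(1 <= n < M) f (m + n)%N * (m%:R * n%:R) * (l m * l n)
  + 2 * \sum_(1 <= k < M) f k *
         \sum_(1 <= m < M) m%:R * (m + k)%:R * (l m * l (m + k)%N) =
  4 * (\sum_(1 <= m < M) m%:R * l m) * (\sum_(1 <= m < M) m%:R * f m * l m) +
  \sum_(1 <= N < M) l N * (f N * (\sum_(1 <= m < N) m%:R * (N%:R - m%:R))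
     - 2 * (\sum_(1 <= k < N) f k * ((N%:R - k%:R) * N%:R))).
Proof.
rewrite lambert_sum => [|m n]; last exact: mulrC.
have -> : \sum_(1 <= k < M) f k *
    (\sum_(1 <= m < M) m%:R * (m + k)%:R * (l m * l (m + k)%N)) =
  \sum_(1 <= k < M) f k * (l k * (2 * k%:R * (\sum_(1 <= m < M) m%:R * l m)
       - \sum_(1 <= m < k) m%:R * (k - m)%:R * l m)) -
  \sum_(1 <= N < M) l N * \sum_(1 <= k < N) f k * ((N - k)%:R * N%:R).
  have <- := lambert_above f (fun k m => (m - k)%:R * m%:R).
  rewrite -sumrB; apply: eq_big_nat => k kM; rewrite -mulrBr; congr (_ * _).
  case/andP: (kM) => k0 _; rewrite (lambert_diff (fun m n => m%:R * n%:R)) //.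
  congr (l k * _ - _); rewrite !(sum_split_at _ kM) !mulrDr !mulr_sumr.
  have comb (a b c d e b' c' d' : R) : a = e - d -> b = b' -> c - c' = d' ->
    a + b + c - c' = e + b' + d' - d by move=> -> -> <-; ring.
  apply: comb; rewrite -?sumrB.
  - apply: eq_big_nat => m /andP[_ mk]; rewrite natrB ?(ltnW mk) // natrD; ring.
  - rewrite natrD; ring.
  apply: eq_big_nat => m /andP[km _]; rewrite natrB ?(ltnW km) // natrD; ring.
set S := \sum_(1 <= m < M) m%:R * l m.
rewrite -sumrB (mulr_sumr _ _ _ 2) (mulr_sumr _ _ _ (4 * S)) -!big_split /=.
apply: eq_big_nat => N /andP[N1 NM].
have -> : \sum_(1 <= m < N) m%:R * (N - m)%:R =
          \sum_(1 <= m < N) m%:R * (N%:R - m%:R) :> R.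
  by apply: eq_big_nat => m /andP[_ mN]; rewrite natrB // ltnW.
have -> : \sum_(1 <= k < N) f k * ((N - k)%:R * N%:R) =
          \sum_(1 <= k < N) f k * ((N%:R - k%:R) * N%:R).
  by apply: eq_big_nat => m /andP[_ mN]; rewrite natrB // ltnW.
ring.
Qed.

Lemma sum_diff_sym (f : nat -> R) (F w : nat -> nat -> R) :
    (forall m n, F m n * w m n = F n m * w n m) -> (forall m, F m m = 0) ->
    (forall m k, F m (m + k)%N = f k) ->
  2 * \sum_(1 <= k < M) f k * (\sum_(1 <= m < M) w m (m + k)%N * (l m * l (m + k)%N)) =
  \sum_(1 <= m < M) \sum_(1 <= n < M) F m n * w m n * (l m * l n).
Proof.
move=> FC F0 Ff; rewrite (@sum_sym (fun m n => F m n * w m n * (l m * l n))); last first.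
  by move=> m n; rewrite FC [l m * _]mulrC.
rewrite [X in _ = _ + X]big1 ?addr0; last by move=> m _; rewrite F0 !mul0r.
rewrite -sum_offdiag => [|m n /l_ge ->]; last by rewrite !mulr0.
congr (_ * _); apply: eq_bigr => k _; rewrite mulr_sumr.
by apply: eq_bigr => m _; rewrite Ff mulrA.
Qed.

Definition lsum (k : nat) : R := \sum_(1 <= n < M) n%:R ^+ k * l n.
(** The image of lsum k under theta, since theta (l n) = n (l n + l n^2) for l
    n = q^n / (1 - q^n). *)
Definition lsum_theta (k : nat) : R :=
  \sum_(1 <= n < M) n%:R ^+ k * (n%:R * (l n + l n ^+ 2)).

Lemma lsumM i j :
  \sum_(1 <= m < M) \sum_(1 <= n < M) m%:R ^+ i * n%:R ^+ j * (l m * l n) =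
  lsum i * lsum j.
Proof.
rewrite /lsum mulr_suml; apply: eq_bigr => m _; rewrite mulr_sumr.
apply: eq_bigr => n _; ring.
Qed.

Lemma sum_pow2 N : 6 * (\sum_(1 <= k < N.+1) k%:R ^+ 2) =
  N%:R * (N%:R + 1) * (2 * N%:R + 1) :> R.
Proof.
elim: N => [|N IH]; first by rewrite big_geq // mulr0 !mul0r.
rewrite big_nat_recr //= mulrDr IH -(addn1 N) natrD; ring.
Qed.

Lemma sum_pow4 N : 30 * (\sum_(1 <= k < N.+1) k%:R ^+ 4) =
  6 * N%:R ^+ 5 + 15 * N%:R ^+ 4 + 10 * N%:R ^+ 3 - N%:R :> R.
Proof.
elim: N => [|N IH]; first by rewrite big_geq //; ring.
rewrite big_nat_recr //= mulrDr IH -(addn1 N) natrD; ring.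
Qed.

Lemma sum_pow5 N : 12 * (\sum_(1 <= k < N.+1) k%:R ^+ 5) =
  2 * N%:R ^+ 6 + 6 * N%:R ^+ 5 + 5 * N%:R ^+ 4 - N%:R ^+ 2 :> R.
Proof.
elim: N => [|N IH]; first by rewrite big_geq //; ring.
rewrite big_nat_recr //= mulrDr IH -(addn1 N) natrD; ring.
Qed.

Lemma sum_pow6 N : 42 * (\sum_(1 <= k < N.+1) k%:R ^+ 6) =
  6 * N%:R ^+ 7 + 21 * N%:R ^+ 6 + 21 * N%:R ^+ 5 - 7 * N%:R ^+ 3 + N%:R :> R.
Proof.
elim: N => [|N IH]; first by rewrite big_geq //; ring.
rewrite big_nat_recr //= mulrDr IH -(addn1 N) natrD; ring.
Qed.

Lemma sum_pow1 N : 2 * (\sum_(1 <= k < N.+1) k%:R) = N%:R * (N%:R + 1) :> R.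
Proof.
elim: N => [|N IH]; first by rewrite big_geq // mulr0 mul0r.
rewrite big_nat_recr //= mulrDr IH -(addn1 N) natrD; ring.
Qed.

(** An even function F m n = f |m - n| folds the sum over differences into the
    full double sum. *)
Lemma liouville1_poly (f : nat -> R) (F : nat -> nat -> R) :
    (forall m n, F m n = F n m) -> (forall m, F m m = 0) ->
    (forall m k, F m (m + k)%N = f k) ->
  \sum_(1 <= m < M) \sum_(1 <= n < M) (f (m + n)%N - F m n) * (l m * l n) =
  \sum_(1 <= N < M)
     (l N * (f N * (N%:R - 1) + 2 * \sum_(1 <= k < N) f k) - 2 * (f N * l N ^+ 2)).
Proof.
move=> FC F0 Ff; rewrite -liouville1.
have -> : \sum_(1 <= k < M) f k * (\sum_(1 <= m < M) l m * l (m + k)%N) =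
    \sum_(1 <= k < M) f k * (\sum_(1 <= m < M) 1 * (l m * l (m + k)%N)).
  by under [RHS]eq_bigr => k _ do under eq_bigr => m _ do rewrite mul1r.
rewrite (@sum_diff_sym _ F (fun _ _ => 1)) // => [|m n]; last by rewrite !mulr1.
rewrite -sumrB; apply: eq_bigr => m _; rewrite -sumrB; apply: eq_bigr => n _.
by rewrite mulr1 mulrBl.
Qed.

Lemma liouville2_poly (f : nat -> R) (F : nat -> nat -> R) :
    (forall m n, F m n = F n m) -> (forall m, F m m = 0) ->
    (forall m k, F m (m + k)%N = f k) ->
  \sum_(1 <= m < M) \sum_(1 <= n < M)
     (f (m + n)%N + F m n) * (m%:R * n%:R) * (l m * l n) =
  4 * (\sum_(1 <= m < M) m%:R * l m) * (\sum_(1 <= m < M) m%:R * f m * l m) +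
  \sum_(1 <= N < M) l N * (f N * (\sum_(1 <= m < N) m%:R * (N%:R - m%:R))
     - 2 * (\sum_(1 <= k < N) f k * ((N%:R - k%:R) * N%:R))).
Proof.
move=> FC F0 Ff; rewrite -liouville2.
rewrite (@sum_diff_sym _ F (fun m n => m%:R * n%:R)) // => [|m n]; last first.
  by rewrite FC (mulrC m%:R).
rewrite -big_split; apply: eq_bigr => m _; rewrite -big_split.
by apply: eq_bigr => n _ /=; rewrite !mulrDl.
Qed.

Lemma diff_pow_sym c e : ~~ odd e -> (0 < e)%N ->
  [/\ forall m n, c * (m%:R - n%:R) ^+ e = c * (n%:R - m%:R) ^+ e :> R,
      forall m, c * (m%:R - m%:R) ^+ e = 0 :> R
    & forall m k, c * (m%:R - (m + k)%:R) ^+ e = c * k%:R ^+ e :> R].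
Proof.
move=> ev e0; have FC m n : c * (m%:R - n%:R) ^+ e = c * (n%:R - m%:R) ^+ e :> R.
  by rewrite -opprB exprNn -signr_odd (negbTE ev) mul1r.
split=> [//|m|m k]; first by rewrite subrr expr0n eqn0Ngt e0 mulr0.
by rewrite FC natrD addrC addKr.
Qed.

(* In both uses f x = c * x^e with e even, where c clears the denominators of
   the power sums. *)
Definition liouville1_pow c e ev e0 :=
  let: And3 FC F0 Ff := @diff_pow_sym c e ev e0 in liouville1_poly FC F0 Ff.
Definition liouville2_pow c e ev e0 :=
  let: And3 FC F0 Ff := @diff_pow_sym c e ev e0 in liouville2_poly FC F0 Ff.

(** Since (m + n)^2 - (m - n)^2 = 4 m n, taking f x = x^2 makes the double sum
    a product of single sums. *)
Lemma lambert_S1S1 : 12 * lsum 1 ^+ 2 = 5 * lsum 3 + lsum 1 - 6 * lsum_theta 1.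
Proof.
have E := @liouville1_pow 3 2 isT isT.
rewrite expr2 -lsumM mulr_sumr.
transitivity (\sum_(1 <= m < M) \sum_(1 <= n < M)
   (3 * (m + n)%:R ^+ 2 - 3 * (m%:R - n%:R) ^+ 2) * (l m * l n)).
  apply: eq_bigr => m _; rewrite mulr_sumr; apply: eq_bigr => n _.
  rewrite natrD; ring.
rewrite {}E /lsum /lsum_theta !mulr_sumr -big_split -sumrB /=.
apply: eq_big_nat => -[|N] // _; rewrite -mulr_sumr.
have := sum_pow2 N; set S := \sum_(_ <= _ < _) _; rewrite -(addn1 N) natrD => H.
have -> : 2 * (3 * S) = 6 * S by ring.
rewrite {}H; ring.
Qed.

(** Here f x = x^4 is used: (m + n)^4 - (m - n)^4 = 8 (m^3 n + m n^3). *)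
Lemma lambert_S1S3 :
  240 * (lsum 1 * lsum 3) = 21 * lsum 5 + 10 * lsum 3 - lsum 1 - 30 * lsum_theta 3.
Proof.
have E := @liouville1_pow 15 4 isT isT.
transitivity (120 * (lsum 1 * lsum 3 + lsum 3 * lsum 1)); first ring.
rewrite -!lsumM -big_split mulr_sumr.
transitivity (\sum_(1 <= m < M) \sum_(1 <= n < M)
   (15 * (m + n)%:R ^+ 4 - 15 * (m%:R - n%:R) ^+ 4) * (l m * l n)).
  apply: eq_bigr => m _; rewrite -big_split mulr_sumr; apply: eq_bigr => n _ /=.
  rewrite natrD; ring.
rewrite {}E /lsum /lsum_theta !mulr_sumr -big_split -!sumrB /=.
apply: eq_big_nat => -[|N] // _; rewrite -mulr_sumr.
have := sum_pow4 N; set S := \sum_(_ <= _ < _) _; rewrite -(addn1 N) natrD => H.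
have -> : 2 * (15 * S) = 30 * S by ring.
rewrite {}H; ring.
Qed.

(** For f x = x^6 the difference (m + n)^6 - (m - n)^6 contains 40 m^3 n^3,
    whence the square of the cubic sum. *)
Lemma lambert_S1S5 :
  504 * (lsum 1 * lsum 5) + 840 * lsum 3 ^+ 2 =
  27 * lsum 7 + 21 * lsum 5 - 7 * lsum 3 + lsum 1 - 42 * lsum_theta 5.
Proof.
have E := @liouville1_pow 21 6 isT isT.
transitivity (252 * (lsum 1 * lsum 5 + lsum 5 * lsum 1)
   + 840 * (lsum 3 * lsum 3)); first ring.
rewrite -!lsumM -big_split !mulr_sumr -big_split.
transitivity (\sum_(1 <= m < M) \sum_(1 <= n < M)
   (21 * (m + n)%:R ^+ 6 - 21 * (m%:R - n%:R) ^+ 6) * (l m * l n)).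
  apply: eq_bigr => m _; rewrite -big_split !mulr_sumr -big_split /=.
  apply: eq_bigr => n _; rewrite natrD; ring.
rewrite {}E [lsum 1]/lsum -big_split -sumrB -big_split -sumrB /=.
apply: eq_big_nat => -[|N] // _; rewrite -mulr_sumr.
have := sum_pow6 N; set S := \sum_(_ <= _ < _) _; rewrite -(addn1 N) natrD => H.
have -> : 2 * (21 * S) = 42 * S by ring.
rewrite {}H; ring.
Qed.

(** The Lambert form of E4^2 = E8; it eliminates the sum of seventh powers
    from the preceding identity. With f x = x^4 the terms m^5 n and m n^5 of
    the double sum cancel against the extra product on the right of the second
    identity. *)
Lemma lambert_S3S3 : 720 * lsum 3 ^+ 2 = 6 * lsum 7 - 6 * lsum 3.
Proof.
have E := @liouville2_pow 60 4 isT isT.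
have S1E : \sum_(1 <= m < M) m%:R * l m = lsum 1 by [].
have S5E : \sum_(1 <= m < M) m%:R * (60 * m%:R ^+ 4) * l m = 60 * lsum 5.
  by rewrite mulr_sumr; apply: eq_bigr => m _; ring.
rewrite {}S1E {}S5E in E.
apply: (@addrI _ (240 * lsum 1 * lsum 5)).
set c := 240 * _ * _; set rhs := 6 * _ - _.
transitivity (120 * (lsum 1 * lsum 5 + lsum 5 * lsum 1)
   + 720 * (lsum 3 * lsum 3)); first by rewrite /c; ring.
rewrite -!lsumM -big_split !mulr_sumr -big_split.
transitivity (\sum_(1 <= m < M) \sum_(1 <= n < M)
   (60 * (m + n)%:R ^+ 4 + 60 * (m%:R - n%:R) ^+ 4) * (m%:R * n%:R) * (l m * l n)).
  apply: eq_bigr => m _; rewrite -big_split !mulr_sumr -big_split /=.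
  apply: eq_bigr => n _; rewrite natrD; ring.
rewrite {}E; congr (_ + _); first by rewrite /c; ring.
rewrite /rhs /lsum !mulr_sumr -!sumrB; apply: eq_big_nat => -[|N] // _.
have -> : \sum_(1 <= m < N.+1) m%:R * (N.+1%:R - m%:R) =
  N.+1%:R * (\sum_(1 <= m < N.+1) m%:R) - \sum_(1 <= m < N.+1) m%:R ^+ 2 :> R.
  by rewrite mulr_sumr -sumrB; apply: eq_bigr => m _; ring.
have -> : \sum_(1 <= k < N.+1) 60 * k%:R ^+ 4 * ((N.+1%:R - k%:R) * N.+1%:R) =
  60 * (N.+1%:R ^+ 2 * (\sum_(1 <= k < N.+1) k%:R ^+ 4) -
        N.+1%:R * (\sum_(1 <= k < N.+1) k%:R ^+ 5)) :> R.
  by rewrite !mulr_sumr -sumrB mulr_sumr; apply: eq_bigr => m _; ring.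
have := sum_pow1 N; set A := \sum_(_ <= _ < _) _ => HA.
have := sum_pow2 N; set B := \sum_(_ <= _ < _) _ => HB.
have := sum_pow4 N; set C := \sum_(_ <= _ < _) _ => HC.
have := sum_pow5 N; set D := \sum_(_ <= _ < _) _ => HD.
rewrite -(addn1 N) natrD; set x := N%:R in HA HB HC HD *.
transitivity (l (N + 1)%N * (30 * (x + 1) ^+ 5 * (2 * A) - 10 * (x + 1) ^+ 4 * (6 * B)
   - 4 * (x + 1) ^+ 2 * (30 * C) + 10 * (x + 1) * (12 * D))); first ring.
rewrite HA HB HC HD; ring.
Qed.

End Lambert.

(** * Power series and the derivation q d/dq *)

Section FpsTheory.
Variable R : comNzRingType.
Implicit Types f g : fps R.

Lemma coef_fps_sum (I : Type) (r : seq I) (P : pred I) (F : I -> fps R) n :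
  (\sum_(i <- r | P i) F i) n = \sum_(i <- r | P i) F i n.
Proof. by elim/big_rec2: _ => // i x y _ <-. Qed.

Lemma coef_fps_natr k n : (k%:R : fps R) n = (n == 0%N)%:R * k%:R.
Proof.
elim: k => [|k IH]; first by rewrite mulr0.
by rewrite -addn1 !natrD coef_fpsD IH mulrDr mulr1.
Qed.

Lemma coef_fpsMn f k n : (k%:R * f) n = k%:R * f n.
Proof.
rewrite coef_fpsM (bigD1 ord0) //= coef_fps_natr mul1r subn0 big1 ?addr0 //.
by move=> i; rewrite -val_eqE /= => /negbTE ni0; rewrite coef_fps_natr ni0 !mul0r.
Qed.

Lemma coef0_fpsM f g : (f * g) 0%N = f 0%N * g 0%N.
Proof. by rewrite coef_fpsM big_ord1. Qed.

Definition fpsC (c : R) : fps R := Fps (fun n => (n == 0%N)%:R * c).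

Lemma coef_fpsCM c f n : (fpsC c * f) n = c * f n.
Proof.
rewrite coef_fpsM (bigD1 ord0) //= mul1r subn0 big1 ?addr0 //.
by move=> i; rewrite -val_eqE /= => /negbTE ->; rewrite !mul0r.
Qed.

Fact fpsC_is_zmod_morphism : zmod_morphism fpsC.
Proof. by move=> a b; apply/fpsP => n; rewrite /= mulrBr. Qed.
Fact fpsC_is_monoid_morphism : monoid_morphism fpsC.
Proof.
split=> [|a b]; apply/fpsP => n; first by rewrite /= mulr1.
by rewrite coef_fpsCM /= mulrCA.
Qed.
HB.instance Definition _ :=
  GRing.isZmodMorphism.Build R (fps R) fpsC fpsC_is_zmod_morphism.
HB.instance Definition _ :=
  GRing.isMonoidMorphism.Build R (fps R) fpsC fpsC_is_monoid_morphism.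

Definition theta f : fps R := Fps (fun n => n%:R * f n).

Fact theta_is_zmod_morphism : zmod_morphism theta.
Proof. by move=> f g; apply/fpsP => n; rewrite /= mulrBr. Qed.
HB.instance Definition _ :=
  GRing.isZmodMorphism.Build (fps R) (fps R) theta theta_is_zmod_morphism.

Lemma thetaM f g : theta (f * g) = theta f * g + f * theta g.
Proof.
apply/fpsP => n; rewrite coef_fpsD /= mulr_sumr -big_split /=.
apply: eq_bigr => i _; rewrite -{1}(subnKC (leq_ord i)) natrD; ring.
Qed.

Lemma thetaC c : theta (fpsC c) = 0.
Proof. by apply/fpsP => -[|n] /=; rewrite !(mul0r, mulr0). Qed.

Lemma theta_nat k : theta k%:R = 0.
Proof. by rewrite -(rmorph_nat fpsC) thetaC. Qed.

Lemma thetaX f n : theta (f ^+ n) = n%:R * f ^+ n.-1 * theta f.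
Proof.
elim: n => [|n IH]; first by rewrite expr0 (theta_nat 1) !mul0r.
rewrite exprS thetaM IH -(addn1 n) natrD /= addn1 /=.
by case: n {IH} => [|n] /=; rewrite ?exprS; ring.
Qed.

Lemma coef_iter_theta k f n : iter k theta f n = n%:R ^+ k * f n.
Proof. by elim: k => [|k IH] /=; rewrite ?mul1r // IH exprS mulrA. Qed.

Lemma coef_fpsXn k n : (fpsX R ^+ k) n = (n == k)%:R.
Proof.
elim: k n => [|k IH] [|n] //.
  by rewrite exprS coef0_fpsM mul0r.
rewrite exprS coef_fpsM big_ord_recl /= mul0r add0r big_ord_recl /= mul1r.
rewrite big1 ?addr0 => [|i _]; last by rewrite mul0r.
by rewrite /bump subSS subn0 IH.
Qed.

Lemma coef_fpsXnM k f n :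
  (fpsX R ^+ k * f) n = if (k <= n)%N then f (n - k)%N else 0.
Proof.
rewrite coef_fpsM; under eq_bigr => i _ do rewrite coef_fpsXn.
case: leqP => kn.
  rewrite (bigD1 (Ordinal (kn : (k < n.+1)%N))) //= eqxx mul1r big1 ?addr0 //.
  by move=> i; rewrite -val_eqE /= => /negbTE ->; rewrite mul0r.
rewrite big1 // => i _; case: eqP => [ik|_]; last by rewrite mul0r.
by have := ltn_ord i; rewrite ik ltnS leqNgt kn.
Qed.

Lemma theta_fpsXn k : theta (fpsX R ^+ k) = k%:R * fpsX R ^+ k.
Proof.
apply/fpsP => n; rewrite coef_fpsMn /= coef_fpsXn.
by case: eqP => [->|]; rewrite ?mulr0.
Qed.

(* In R[X] / (X^(N+1)) the Lambert series with index above N vanish, so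
   identities between finite sums apply there. *)
Variable N : nat.
Definition trunc_q f : {poly %/ 'X^(N.+1)} := in_qpoly 'X^(N.+1) (fps_trunc N.+1 f).

Lemma trunc_qE f : trunc_q f = fps_trunc N.+1 f :> {poly R}.
Proof.
rewrite in_qpoly_small // mk_monic_Xn size_polyXn ltnS; exact: size_poly.
Qed.

Lemma in_qpoly_take (p : {poly R}) :
  in_qpoly 'X^(N.+1) p = in_qpoly 'X^(N.+1) (take_poly N.+1 p).
Proof.
rewrite -{1}(poly_take_drop N.+1 p) in_qpolyD in_qpolyM.
have -> : @in_qpoly R 'X^(N.+1) 'X^(N.+1) = 0 :> {poly %/ 'X^(N.+1)}.
  by apply/val_eqP; rewrite /= mk_monic_Xn Pdiv.RingMonic.rmodpp ?monicXn.
by rewrite mulr0 addr0.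
Qed.

Fact trunc_q_is_zmod_morphism : zmod_morphism trunc_q.
Proof.
move=> f g; rewrite /trunc_q -raddfB; congr in_qpoly; apply/polyP => i.
by rewrite coefB !coef_poly; case: ifP => // _; rewrite subr0.
Qed.
Fact trunc_q_is_monoid_morphism : monoid_morphism trunc_q.
Proof.
split=> [|f g].
  apply: (etrans _ (in_qpoly1 _)); congr in_qpoly.
  by apply/polyP => i; rewrite coef_poly coef1; case: ltnP => //; case: i.
transitivity (in_qpoly 'X^(N.+1) (fps_trunc N.+1 f * fps_trunc N.+1 g)).
  rewrite [RHS]in_qpoly_take.
  congr in_qpoly; apply/polyP => i.
  rewrite coef_take_poly coef_poly; case: ifP => // iN.
  by rewrite -fps_mul_trunc.
exact: in_qpolyM.
Qed.
HB.instance Definition _ := GRing.isZmodMorphism.Build (fps R) {poly %/ 'X^(N.+1)}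
  trunc_q trunc_q_is_zmod_morphism.
HB.instance Definition _ := GRing.isMonoidMorphism.Build (fps R) {poly %/ 'X^(N.+1)}
  trunc_q trunc_q_is_monoid_morphism.

Lemma trunc_qP f g :
  (forall n, (n <= N)%N -> f n = g n) <-> trunc_q f = trunc_q g.
Proof.
split=> [fg | /(congr1 val) /=].
  congr in_qpoly; apply/polyP => i; rewrite !coef_poly; case: ifP => // iN.
  exact: fg.
rewrite -[LHS]/(trunc_q f : {poly R}) -[RHS]/(trunc_q g : {poly R}) !trunc_qE.
by move=> /polyP fg n nN; have := fg n; rewrite !coef_fps_trunc.
Qed.
End FpsTheory.

Lemma fps_idomain_axiom (R : idomainType) : GRing.integral_domain_axiom (fps R).
Proof.
move=> f g fg0; apply/norP => -[f0 g0].
have ex h : h != 0 :> fps R -> exists n, h n != 0.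
  move=> hn0; apply: boolp.contrapT => /boolp.forallNP h0; case/eqP: hn0.
  by apply/fpsP => n; apply/eqP; have /negP := h0 n; rewrite negbK.
case: (ex_minnP (ex f f0)) => i fi mini; case: (ex_minnP (ex g g0)) => j gj minj.
have small (h : fps R) m : (forall n, h n != 0 -> (m <= n)%N) ->
    forall n, (n < m)%N -> h n = 0.
  by move=> hm n; rewrite ltnNge; apply: contraNeq; apply: hm.
move/fpsP/(_ (i + j)%N): fg0; rewrite coef_fpsM.
rewrite (bigD1 (Ordinal (leq_addr j i : (i < (i + j).+1)%N))) //= addKn.
rewrite big1 => [|k]; first by apply/eqP; rewrite addr0 mulf_neq0.
rewrite -val_eqE /= => ki; case: (ltngtP k i) ki => // ki _.
  by rewrite (small f i) ?mul0r.
by rewrite (small g j) ?mulr0 //; move: (ltn_ord k); lia.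
Qed.
HB.instance Definition _ (R : idomainType) :=
  GRing.ComUnitRing_isIntegral.Build (fps R) (@fps_idomain_axiom R).

Section MapFps.
Variables (A B : comNzRingType) (phi : {rmorphism A -> B}).
Definition map_fps (f : fps A) : fps B := Fps (fun n => phi (f n)).

Fact map_fps_is_zmod_morphism : zmod_morphism map_fps.
Proof. by move=> f g; apply/fpsP => n; rewrite /= rmorphB. Qed.
Fact map_fps_is_monoid_morphism : monoid_morphism map_fps.
Proof.
split=> [|f g]; apply/fpsP => n /=; first by rewrite rmorph_nat.
by rewrite rmorph_sum; apply: eq_bigr => i _; rewrite rmorphM.
Qed.
HB.instance Definition _ := GRing.isZmodMorphism.Build (fps A) (fps B)
  map_fps map_fps_is_zmod_morphism.
HB.instance Definition _ := GRing.isMonoidMorphism.Build (fps A) (fps B)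
  map_fps map_fps_is_monoid_morphism.

Lemma map_theta f : map_fps (theta f) = theta (map_fps f).
Proof. by apply/fpsP => n; rewrite /= rmorphM rmorph_nat. Qed.
End MapFps.

(** * Ramanujan's differential equations *)

Section Ramanujan.

Definition lambert (n : nat) : fps int :=
  Fps (fun N => ((0 < N)%N && (n %| N)%N)%:R).

Lemma lambertP n : (0 < n)%N -> lambert n * (1 - fpsX int ^+ n) = fpsX int ^+ n.
Proof.
move=> n0; apply/fpsP => N; rewrite mulrBr mulr1 mulrC coef_fpsD coef_fpsN.
rewrite coef_fpsXnM coef_fpsXn /=; case: (leqP n N) => nN; last first.
  rewrite subr0 (ltn_eqF nN); case: N nN => // N nN.
  by rewrite gtnNdvd.
rewrite subn_gt0 (dvdn_subl nN (dvdnn n)); case: eqP => [->|nEN] /=.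
  by rewrite ltnn n0 dvdnn subr0.
rewrite [(n < N)%N]ltn_neqAle nN eq_sym; case: eqP => // _.
by case: N nN nEN => [|N]; rewrite ?subrr //; lia.
Qed.

Lemma unit_1subXn n : (0 < n)%N -> (1 - fpsX int ^+ n) \is a GRing.unit.
Proof.
move=> n0; rewrite unfold_in /= /fps_unit coef_fpsD coef_fpsN coef_fps1 coef_fpsXn.
by rewrite (ltn_eqF n0) subr0 unitr1.
Qed.

(** With x = q^m and y = q^n this is an identity between rational functions of
    x and y; the denominators are units. *)
Lemma lambert_mul m n : (0 < m)%N -> (0 < n)%N ->
  lambert m * lambert n = lambert (m + n) * (1 + lambert m + lambert n).
Proof.
move=> m0 n0; have mn0 : (0 < m + n)%N by rewrite addn_gt0 m0.
apply: (mulIr (unit_1subXn m0)); apply: (mulIr (unit_1subXn n0)).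
apply: (mulIr (unit_1subXn mn0)).
have Em := lambertP m0; have En := lambertP n0; have Emn := lambertP mn0.
rewrite exprD in Emn *.
set x := fpsX int ^+ m in Em Emn *; set y := fpsX int ^+ n in En Emn *.
transitivity ((lambert m * (1 - x)) * (lambert n * (1 - y)) * (1 - x * y)); first ring.
transitivity ((lambert (m + n) * (1 - x * y)) * ((1 - x) * (1 - y)
   + lambert m * (1 - x) * (1 - y) + lambert n * (1 - y) * (1 - x))); last ring.
rewrite Em En Emn; ring.
Qed.

Lemma theta_lambert n : (0 < n)%N ->
  theta (lambert n) = n%:R * (lambert n + lambert n ^+ 2).
Proof.
move=> n0; apply: (mulIr (unit_1subXn n0)).
have E := lambertP n0; have := congr1 (@theta _) E.
rewrite thetaM raddfB /= (theta_nat _ 1) theta_fpsXn sub0r => E'.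
transitivity (n%:R * (1 + lambert n) * (lambert n * (1 - fpsX int ^+ n))); last ring.
by apply: (addIr (lambert n * - (n%:R * fpsX int ^+ n))); rewrite E' E; ring.
Qed.

Definition sigma_series k : fps int :=
  Fps (fun N => if N == 0%N then 0 else (sigma k N)%:Z).

Lemma sigma_seriesE k M N : (N < M)%N ->
  sigma_series k N = (\sum_(1 <= n < M) n%:R ^+ k * lambert n) N.
Proof.
move=> NM; rewrite coef_fps_sum [LHS]/=; case: N NM => [|N] NM.
  rewrite big1 // => n _; rewrite -natrX coef_fpsMn /= mulr0 //.
rewrite [LHS]/= /sigma (perm_big [seq d <- index_iota 1 M | (d %| N.+1)%N]); last first.
  apply: uniq_perm; rewrite ?divisors_uniq ?filter_uniq ?iota_uniq // => d.
  rewrite -dvdn_divisors // mem_filter mem_index_iota; case: (boolP (d %| _)%N) => //= dN.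
  by have := dvdn_leq (ltn0Sn N) dN; have := dvdn_gt0 (ltn0Sn N) dN; lia.
rewrite big_filter big_mkcond -natz natr_sum; apply: eq_bigr => d _.
rewrite -natrX coef_fpsMn /=; case: ifP => _; rewrite ?mulr1 ?mulr0 //.
Qed.

(** Two series are equal when all their truncations are, and modulo q^(N+1)
    the series of divisor sums are the finite Lambert sums. *)
Lemma ramanujan_sigma :
  [/\ 12 * sigma_series 1 ^+ 2 =
        5 * sigma_series 3 + sigma_series 1 - 6 * theta (sigma_series 1),
      240 * (sigma_series 1 * sigma_series 3) =
        21 * sigma_series 5 + 10 * sigma_series 3 - sigma_series 1
        - 30 * theta (sigma_series 3),
      504 * (sigma_series 1 * sigma_series 5) + 840 * sigma_series 3 ^+ 2 =
        27 * sigma_series 7 + 21 * sigma_series 5 - 7 * sigma_series 3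
        + sigma_series 1 - 42 * theta (sigma_series 5)
    & 720 * sigma_series 3 ^+ 2 = 6 * sigma_series 7 - 6 * sigma_series 3].
Proof.
have ext (f g : fps int) : (forall N, trunc_q N f = trunc_q N g) -> f = g.
  by move=> fg; apply/fpsP => N; have /trunc_qP := fg N; apply.
pose l N n := trunc_q N (lambert n).
have l_ge N n : (N.+1 <= n)%N -> l N n = 0.
  move=> Nn; rewrite -(raddf0 (@trunc_q int N)); apply/trunc_qP => m mN /=.
  by case: m mN => // m mN; rewrite gtnNdvd //; lia.
have l_mul N m n : (0 < m)%N -> (0 < n)%N ->
    l N m * l N n = l N (m + n)%N * (1 + l N m + l N n).
  by move=> m0 n0; rewrite /l -rmorphM lambert_mul // rmorphM !rmorphD rmorph1.
have SE N k : lsum N.+1 (l N) k = trunc_q N (sigma_series k).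
  have -> : lsum N.+1 (l N) k =
      trunc_q N (\sum_(1 <= n < N.+1) n%:R ^+ k * lambert n).
    rewrite rmorph_sum; apply: eq_bigr => n _.
    by rewrite rmorphM rmorphXn rmorph_nat.
  by apply/trunc_qP => n nN; rewrite (@sigma_seriesE k N.+1).
have DE N k : lsum_theta N.+1 (l N) k = trunc_q N (theta (sigma_series k)).
  have -> : lsum_theta N.+1 (l N) k =
      trunc_q N (theta (\sum_(1 <= n < N.+1) n%:R ^+ k * lambert n)).
    rewrite raddf_sum rmorph_sum; apply: eq_big_nat => n /andP[n0 _].
    rewrite /= -[X in theta (X * _)]natrX thetaM theta_nat mul0r add0r theta_lambert //.
    by rewrite !rmorphM rmorphD rmorphXn !rmorph_nat -natrX.
  by apply/trunc_qP => n nN; rewrite /= -(@sigma_seriesE k N.+1).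
split; apply: ext => N.
- have := lambert_S1S1 (l_ge N) (l_mul N); rewrite !SE !DE => E.
  by rewrite !(rmorph_nat, rmorphB, rmorphD, rmorphM, rmorphXn).
- have := lambert_S1S3 (l_ge N) (l_mul N); rewrite !SE !DE => E.
  by rewrite !(rmorph_nat, rmorphB, rmorphD, rmorphM, rmorphXn).
- have := lambert_S1S5 (l_ge N) (l_mul N); rewrite !SE !DE => E.
  by rewrite !(rmorph_nat, rmorphB, rmorphD, rmorphM, rmorphXn).
have := lambert_S3S3 (l_ge N) (l_mul N); rewrite !SE => E.
by rewrite !(rmorph_nat, rmorphB, rmorphD, rmorphM, rmorphXn).
Qed.

Lemma E2E : E2 = 1 - 24 * sigma_series 1.
Proof.
apply/fpsP => N; rewrite coef_fpsD coef_fpsN coef_fps1 coef_fpsMn /=.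
by case: eqP => _; rewrite ?mulr0 ?subr0 ?sub0r ?mulNr.
Qed.

Lemma E4E : E4 = 1 + 240 * sigma_series 3.
Proof.
apply/fpsP => N; rewrite coef_fpsD coef_fps1 coef_fpsMn /=.
by case: eqP => _; rewrite ?mulr0 ?addr0 ?add0r.
Qed.

Lemma E6E : E6 = 1 - 504 * sigma_series 5.
Proof.
apply/fpsP => N; rewrite coef_fpsD coef_fpsN coef_fps1 coef_fpsMn /=.
by case: eqP => _; rewrite ?mulr0 ?subr0 ?sub0r ?mulNr.
Qed.

(** Stated over an abstract ring so that the linear algebra does not see any
    power series; s7 is eliminated between the last two relations. *)
Lemma ramanujan_algebra (R : comNzRingType) (s1 s3 s5 s7 d1 d3 d5 : R) :
    12 * s1 ^+ 2 = 5 * s3 + s1 - 6 * d1 ->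
    240 * (s1 * s3) = 21 * s5 + 10 * s3 - s1 - 30 * d3 ->
    504 * (s1 * s5) + 840 * s3 ^+ 2 = 27 * s7 + 21 * s5 - 7 * s3 + s1 - 42 * d5 ->
    720 * s3 ^+ 2 = 6 * s7 - 6 * s3 ->
  let e2 := 1 - 24 * s1 in let e4 := 1 + 240 * s3 in let e6 := 1 - 504 * s5 in
  [/\ 12 * - (24 * d1) = e2 ^+ 2 - e4,
      3 * (240 * d3) = e2 * e4 - e6
    & 2 * - (504 * d5) = e2 * e6 - e4 ^+ 2].
Proof.
move=> H11 H13 H15 H33 e2 e4 e6; rewrite /e2 /e4 /e6; split.
- transitivity (- (48 * s1) + 48 * (12 * s1 ^+ 2) - 240 * s3); last ring.
  rewrite H11; ring.
- transitivity (- (24 * s1) + 240 * s3 - 24 * (240 * (s1 * s3)) + 504 * s5); last ring.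
  rewrite H13; ring.
transitivity (- (24 * s1) - 504 * s5 + 24 * (504 * (s1 * s5) + 840 * s3 ^+ 2)
   - 480 * s3 - 108 * (720 * s3 ^+ 2)); last ring.
rewrite H15 H33; ring.
Qed.

Lemma ramanujan_ode :
  [/\ 12 * theta E2 = E2 ^+ 2 - E4,
      3 * theta E4 = E2 * E4 - E6
    & 2 * theta E6 = E2 * E6 - E4 ^+ 2].
Proof.
move: E2 E4 E6 E2E E4E E6E ramanujan_sigma.
move: (sigma_series 1) (sigma_series 3) (sigma_series 5) (sigma_series 7).
move=> s1 s3 s5 s7 e2 e4 e6 -> -> -> [H11 H13 H15 H33].
have thetaMn k (f : fps int) : theta (k%:R * f) = k%:R * theta f.
  by rewrite thetaM theta_nat mul0r add0r.
have theta1 : theta (1 : fps int) = 0 by exact: (theta_nat _ 1).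
have thetaB1 k (f : fps int) : theta (1 - k%:R * f) = - (k%:R * theta f).
  by rewrite raddfB /= theta1 thetaMn sub0r.
have thetaD1 k (f : fps int) : theta (1 + k%:R * f) = k%:R * theta f.
  by rewrite raddfD /= theta1 thetaMn add0r.
rewrite !thetaB1 thetaD1.
exact: ramanujan_algebra H11 H13 H15 H33.
Qed.
End Ramanujan.

(** * Local exponents of the equation of the squared Hasse invariant *)

Section HasseODE.
Variables (K : fieldType) (l : nat).
Hypothesis l_char : l \in [pchar K].
Hypothesis l_gt3 : (3 < l)%N.
Implicit Types (g a u : {poly K}) (z : K).

Lemma natr_pchar_eq0 n : (n%:R == 0 :> K) = (l %| n)%N.
Proof. by rewrite (dvdn_pcharf l_char). Qed.

Lemma natr_neq0_smooth n : (0 < n)%N -> (forall p, prime p -> (p %| n)%N -> (p <= 3)%N) ->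
  n%:R != 0 :> K.
Proof.
move=> n0 small; rewrite natr_pchar_eq0; apply/negP => ln.
by have := small l (pcharf_prime l_char) ln; rewrite leqNgt l_gt3.
Qed.

Lemma pow23_neq0 i j : (2 ^ i * 3 ^ j)%:R != 0 :> K.
Proof.
apply: natr_neq0_smooth => [|p pp]; first by rewrite muln_gt0 !expn_gt0.
by rewrite Euclid_dvdM // => /orP[]; rewrite Euclid_dvdX // => /andP[/dvdn_leq]; lia.
Qed.

Lemma horner_natr n z : (n%:R : {poly K}).[z] = n%:R.
Proof. exact: (rmorph_nat (horner_eval z)). Qed.

Lemma horner_one z : (1 : {poly K}).[z] = 1.
Proof. exact: hornerC. Qed.

(* The rules for numerals come first, as the general ones would unfold a
   numeral into a sum of ones. *)
Definition evalE := (horner_one, horner_natr, (hornerD, hornerN, hornerM, horner_exp),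
  (hornerX, hornerC)).

Lemma euler_mul z m u : let y := 'X - z%:P in
  y * (y ^+ m * u)^`() = y ^+ m * (m%:R * u + y * u^`()).
Proof.
move=> y; rewrite derivM deriv_exp derivXsubC mul1r mulrDr; case: m => [|m].
  by rewrite mulr0n !mul0r mulr0 !add0r expr0; ring.
by rewrite -mulr_natl /= exprS; ring.
Qed.

Lemma euler_mul2 z m u : let y := 'X - z%:P in let w := m%:R * u + y * u^`() in
  y ^+ 2 * (y ^+ m * u)^`()^`() = y ^+ m * (m%:R * w + y * w^`() - w).
Proof.
move=> y w; have E := euler_mul z m u; have /(congr1 (fun p => y * p^`())) := E.
rewrite -/y -/w (euler_mul z m w) -/y [(y * _)^`()]derivM derivXsubC mul1r => E2.
rewrite mulrBr -E2 mulrDr E -/y -/w; ring.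
Qed.

(** The equation satisfied by the square of the Hasse invariant as a
    polynomial in xi. It is quadratic because it is obtained from a linear
    equation for the square root; see [hasse_ode_sqr]. *)
Definition hasse_ode g : {poly K} :=
  72 * ('X - 1) * g * ('X ^+ 2 * g^`()^`()) - 36 * ('X - 1) * ('X * g^`()) ^+ 2
  + 72 * (2 * 'X - 1) * g * ('X * g^`()) + (27 * 'X + 4) * g ^+ 2.

(** The indicial equation at a regular point: the exponents of the square root
    are 0 and 1, so those of g are 0 and 2. *)
Lemma ode_mult g z m u : hasse_ode g = 0 -> z != 0 -> z != 1 ->
  g = ('X - z%:P) ^+ m * u -> u.[z] != 0 -> m%:R * (m%:R - 2) = 0 :> K.
Proof.
move=> ode z0 z1 gE uz; set y := 'X - z%:P in gE.
have yz : y.[z] = 0 by rewrite hornerXsubC subrr.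
set w := m%:R * u + y * u^`(); set v := m%:R * w + y * w^`() - w.
have g1 : y * g^`() = y ^+ m * w by rewrite gE euler_mul.
have g2 : y ^+ 2 * g^`()^`() = y ^+ m * v by rewrite gE euler_mul2.
have y0 : y != 0 by rewrite polyXsubC_eq0.
clearbody y.
have : y ^+ 2 * hasse_ode g = (y ^+ m) ^+ 2 * (
  72 * ('X - 1) * 'X ^+ 2 * u * v - 36 * ('X - 1) * 'X ^+ 2 * w ^+ 2
  + 72 * (2 * 'X - 1) * 'X * y * u * w + (27 * 'X + 4) * y ^+ 2 * u ^+ 2).
  transitivity (72 * ('X - 1) * g * ('X ^+ 2 * (y ^+ 2 * g^`()^`()))
     - 36 * ('X - 1) * ('X * (y * g^`())) ^+ 2
     + 72 * (2 * 'X - 1) * y * g * ('X * (y * g^`())) + (27 * 'X + 4) * y ^+ 2 * g ^+ 2).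
    by rewrite /hasse_ode; ring.
  by rewrite g1 g2 gE; ring.
rewrite ode mulr0 => /esym/eqP; rewrite mulf_eq0 !expf_eq0 (negbTE y0) andbF /=.
move/eqP/(congr1 (horner^~ z)); rewrite /v /w !evalE yz => E.
have : 36 * ((z - 1) * z ^+ 2 * u.[z] ^+ 2) * (m%:R * (m%:R - 2)) = 0 :> K.
  rewrite -[RHS]E; ring.
move/eqP; rewrite mulf_eq0 => /orP[|/eqP //].
have c0 : 36 != 0 :> K := pow23_neq0 2 2.
suff /negbTE -> : 36 * ((z - 1) * z ^+ 2 * u.[z] ^+ 2) != 0 by [].
by rewrite !mulf_neq0 ?expf_neq0 // subr_eq0.
Qed.

(** The indicial equation at 0, with exponents 1/3 and -1/3. *)
Lemma ode_mult0 g m u : hasse_ode g = 0 -> g = 'X ^+ m * u -> u.[0] != 0 ->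
  (3 * m%:R - 1) * (3 * m%:R + 1) = 0 :> K.
Proof.
move=> ode gE u0.
have yE : 'X - 0%:P = 'X :> {poly K} by rewrite subr0.
set w := m%:R * u + 'X * u^`(); set v := m%:R * w + 'X * w^`() - w.
have g1 : 'X * g^`() = 'X ^+ m * w by have := euler_mul 0 m u; rewrite yE gE.
have g2 : 'X ^+ 2 * g^`()^`() = 'X ^+ m * v.
  by have := euler_mul2 0 m u; rewrite yE gE.
have : hasse_ode g = ('X ^+ m) ^+ 2 * (
  72 * ('X - 1) * u * v - 36 * ('X - 1) * w ^+ 2
  + 72 * (2 * 'X - 1) * u * w + (27 * 'X + 4) * u ^+ 2).
  by rewrite /hasse_ode g1 g2 gE; ring.
rewrite ode => /esym/eqP; rewrite mulf_eq0 !expf_eq0 polyX_eq0 !andbF /=.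
move/eqP/(congr1 (horner^~ 0)); rewrite /v /w !evalE => E.
have : u.[0] ^+ 2 * (4 * ((3 * m%:R - 1) * (3 * m%:R + 1))) = 0 :> K.
  by apply: oppr_inj; rewrite oppr0 -[RHS]E; ring.
have c0 : 4 != 0 :> K := pow23_neq0 2 0.
by move/eqP; rewrite mulf_eq0 expf_eq0 /= (negbTE u0) mulf_eq0 (negbTE c0) => /eqP.
Qed.

Lemma coefM_top (p q : {poly K}) i j : (size p <= i.+1)%N -> (size q <= j.+1)%N ->
  (p * q)`_(i + j) = p`_i * q`_j.
Proof.
move=> sp sq; rewrite coefM (bigD1 (Ordinal (leq_addr j i : (i < (i + j).+1)%N))) //=.
rewrite addKn big1 ?addr0 // => k; rewrite -val_eqE /= => ki.
case: (ltngtP k i) ki => // ki _; last by rewrite [p`_k]nth_default ?mul0r ?(leq_trans sp).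
by rewrite [q`_ _]nth_default ?mulr0 // (leq_trans sq) //; move: (ltn_ord k); lia.
Qed.

Lemma coef_euler (p : {poly K}) i : ('X * p^`())`_i = i%:R * p`_i.
Proof. by case: i => [|i]; rewrite coefXM ?mul0r //= coef_deriv mulr_natl. Qed.

Lemma coef_euler2 (p : {poly K}) i :
  ('X ^+ 2 * p^`()^`())`_i = i%:R * (i%:R - 1) * p`_i.
Proof.
case: i => [|[|i]]; rewrite coefXnM ?subrr ?mulr0 ?mul0r //=.
rewrite subn2 /= !coef_deriv -[_ *+ i.+1]mulr_natl -[_ *+ i.+2]mulr_natl.
by rewrite -(addn1 i.+1) natrD; ring.
Qed.

(** The indicial equation at infinity, read off from the leading
    coefficient. *)
Lemma ode_degree g d : hasse_ode g = 0 -> size g = d.+1 ->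
  (2 * d%:R + 1) * (2 * d%:R + 3) = 0 :> K.
Proof.
move=> ode sg.
have gd : g`_d != 0.
  by rewrite -[d]/(d.+1.-1) -sg -lead_coefE lead_coef_eq0 -size_poly_eq0 sg.
set g1 := 'X * g^`(); set g2 := 'X ^+ 2 * g^`()^`().
have s1 : (size g1 <= d.+1)%N.
  apply/leq_sizeP => j dj; rewrite coef_euler nth_default ?mulr0 //.
  by rewrite sg.
have s2 : (size g2 <= d.+1)%N.
  by apply/leq_sizeP => j dj; rewrite coef_euler2 nth_default ?mulr0 // sg.
pose q1 := 72 * (g * g2) - 36 * (g1 * g1) + 144 * (g * g1) + 27 * (g * g).
pose q2 := - (72 * (g * g2)) + 36 * (g1 * g1) - 72 * (g * g1) + 4 * (g * g).
have odeE : hasse_ode g = 'X * q1 + q2.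
  by rewrite /hasse_ode -/g1 -/g2 /q1 /q2; ring.
have sM (p q : {poly K}) : (size p <= d.+1)%N -> (size q <= d.+1)%N ->
    (size (p * q)%R <= (d + d).+1)%N.
  move=> sp sq; apply: (leq_trans (size_polyMleq _ _)); lia.
have cN k (p : {poly K}) i : (k%:R * p)`_i = k%:R * p`_i.
  by rewrite mulr_natl coefMn mulr_natl.
have sg' : (size g <= d.+1)%N by rewrite sg.
have q20 : q2`_(d + d).+1 = 0.
  rewrite !(coefD, coefN) !cN !nth_default ?sM //; ring.
have : ('X * q1 + q2)`_(d + d).+1 = 0 by rewrite -odeE ode coef0.
rewrite coefD q20 addr0 coefXM /= !(coefD, coefN) !cN !coefM_top //.
rewrite !coef_euler !coef_euler2 => E.
have : 9 * (g`_d ^+ 2 * ((2 * d%:R + 1) * (2 * d%:R + 3))) = 0 :> K.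
  rewrite -[RHS]E; ring.
have c0 : 9 != 0 :> K := pow23_neq0 0 2.
by move/eqP; rewrite mulf_eq0 (negbTE c0) mulf_eq0 expf_eq0 /= (negbTE gd) => /eqP.
Qed.

End HasseODE.

(** * The square root *)

Lemma seq_half (T : eqType) (s : seq T) :
  (forall x, ~~ odd (count_mem x s)) -> exists r, perm_eq s (r ++ r).
Proof.
have [n] := ubnP (size s); elim: n s => // n IH [|x s] /=; first by exists [::].
rewrite ltnS => sn ev; have xs : x \in s.
  by have := ev x; rewrite eqxx /= -has_pred1 has_count; case: count.
have [|y|r rP] := IH (rem x s).
- by rewrite size_rem //; move: sn xs; case: (s) => //= ? ? ?; lia.
- have /permP/(_ (pred1 y)) /= E := perm_to_rem xs.
  by have := ev y; rewrite E /= addnA oddD; case: eqP; rewrite ?addbF.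
exists (x :: r); rewrite /= perm_cons (perm_trans (perm_to_rem xs)) //.
by rewrite perm_sym -cat1s perm_catCA /= perm_cons perm_sym.
Qed.

Section HasseRoot.
Variables (K : closedFieldType) (l n : nat).
Hypothesis l_char : l \in [pchar K].
Hypothesis l_gt3 : (3 < l)%N.
Hypothesis ln : l = n.*2.+1.
Implicit Types (g a u : {poly K}) (z : K).

Lemma mupP g z : g != 0 -> exists2 u, u.[z] != 0 & g = ('X - z%:P) ^+ mup z g * u.
Proof.
move=> g0; have [m [u]] := multiplicity_XsubC g z; rewrite g0 /= => uz gE.
exists u; first exact: uz.
have u0 : u != 0 by apply: contraNneq uz => ->; rewrite root0.
rewrite gE mupMr // mup_XsubCX eqxx mulrC //.
Qed.

Lemma mup_leq_size g z : g != 0 -> (mup z g < size g)%N.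
Proof.
move=> g0; have : ('X - z%:P) ^+ mup z g %| g by rewrite -mup_geq.
by move/dvdp_leq => /(_ g0); rewrite size_exp_XsubC.
Qed.

(** The size of g bounds the multiplicity by l, so the indicial equation
    determines it and not only its residue. *)
Lemma ode_mup g z : g != 0 -> (size g <= l)%N -> hasse_ode g = 0 -> g.[1] != 0 ->
  z != 0 -> mup z g = 0%N \/ mup z g = 2%N.
Proof.
move=> g0 sg ode g1 z0; case: (eqVneq z 1) => [->|z1].
  by left; apply: mupNroot.
have [u uz gE] := mupP z g0; have := mup_leq_size z g0.
move: (mup z g) gE => m gE ms.
have := ode_mult l_char l_gt3 ode z0 z1 gE uz.
case: m gE ms => [|[|m]] gE ms; [by left | |].
  by rewrite (_ : 1 * (1 - 2) = - 1) ?oppr_eq0 => [/eqP|]; [rewrite oppr_eq0 oner_eq0|ring].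
rewrite -(@natrB _ m.+2 2) // subn2 /= => /eqP; rewrite mulf_eq0 !(natr_pchar_eq0 l_char).
case: m gE ms => [|m] gE ms; first by right.
by case/orP => /dvdn_leq; lia.
Qed.

Lemma ode_mup0 g : g != 0 -> (size g <= l)%N -> hasse_ode g = 0 ->
  [/\ (3 * mup 0 g = n.*2)%N \/ (3 * mup 0 g = n.*2.+2)%N &
      (2 * (size g).-1 = n.*2)%N \/ (2 * (size g).-1 + 2 = n.*2)%N].
Proof.
move=> g0 sg ode.
have sgE : size g = (size g).-1.+1 by rewrite prednK // size_poly_gt0.
have dP : (2 * (size g).-1 = n.*2)%N \/ (2 * (size g).-1 + 2 = n.*2)%N.
  have := ode_degree l_char l_gt3 ode sgE; move: (size g).-1 sgE sg => d -> sg.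
  rewrite -natrM -(natrD _ _ 1) -natrD => /eqP; rewrite mulf_eq0 !(natr_pchar_eq0 l_char).
  by case/orP => /dvdnP[q]; case: q => [|[|q]]; nia.
split => //.
have [u uz] := mupP 0 g0; rewrite subr0; have := mup_leq_size 0 g0.
move: (mup 0 g) => m ms gE.
have := ode_mult0 l_char l_gt3 ode gE uz.
rewrite -natrM; case: m gE ms => [|m] gE ms.
  by rewrite (_ : _ * _ = - 1) => [/eqP|]; [rewrite oppr_eq0 oner_eq0|ring].
rewrite -(@natrB _ _ 1); last by lia.
rewrite -(natrD _ _ 1) => /eqP; rewrite mulf_eq0 !(natr_pchar_eq0 l_char).
by case/orP => /dvdnP[q]; case: q => [|[|q]]; nia.
Qed.

(** All multiplicities are even: they are 0 or 2 away from 0, and three times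
    the one at 0 is l - 1 or l + 1. The numbers ua and va are the exponents of
    E4 and E6 in the Hasse invariant. *)
Lemma ode_sqrt g : (size g <= l)%N -> hasse_ode g = 0 -> g.[1] = 1 ->
  exists a : {poly K}, [/\ g = a ^+ 2, a.[1] = 1,
    (forall z, z != 0 -> root a z -> mup z a = 1%N),
    exists2 ua, (ua <= 1)%N & (3 * mup 0 a = n + ua)%N &
    exists2 va, (va <= 1)%N & (2 * (size a).-1 + va = n)%N].
Proof.
move=> sg ode g1.
have g0 : g != 0 by apply/eqP => g0; move/eqP: g1; rewrite g0 horner0 eq_sym oner_eq0.
have g1' : g.[1] != 0 by rewrite g1 oner_neq0.
have [rs gE] := closed_field_poly_normal g.
have lc0 : lead_coef g != 0 by rewrite lead_coef_eq0.
have mu z : mup z g = count_mem z rs.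
  by rewrite gE -mul_polyC mupMr ?rootC // mu_prod_XsubC.
have [m0 dP] := ode_mup0 g0 sg ode.
have [z|r rP] := @seq_half _ rs.
  rewrite -mu; case: (eqVneq z 0) => [->|z0].
    by case: m0 => /(congr1 odd); rewrite oddM /= ?negbK odd_double => ->.
  by case: (ode_mup g0 sg ode g1' z0) => ->.
pose P := \prod_(z <- r) ('X - z%:P).
have gE' : g = (lead_coef g)%:P * P ^+ 2.
  by rewrite {1}gE (perm_big _ rP) big_cat /= -mul_polyC expr2.
have lcE : lead_coef g * P.[1] ^+ 2 = 1.
  by have /esym := congr1 (horner^~ 1) gE'; rewrite hornerM hornerC horner_exp g1.
have P1 : P.[1] != 0.
  by apply/eqP => P10; move/eqP: lcE; rewrite P10 expr0n mulr0 eq_sym oner_eq0.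
pose a := P.[1]^-1%:P * P.
have aE : g = a ^+ 2.
  rewrite gE' /a exprMn -rmorphXn /=; congr (_%:P * _).
  by apply: (mulIf (expf_neq0 2 P1)); rewrite lcE exprVn mulVf // expf_neq0.
have a0 : a != 0 by apply: contraNneq g0 => a0; rewrite aE a0 expr0n.
have mua z : mup z g = (2 * mup z a)%N by rewrite aE expr2 mupM // mul2n addnn.
exists a; split=> //.
- by rewrite hornerM hornerC mulVf.
- move=> z z0 rz; have : (0 < mup z a)%N by rewrite -XsubC_dvd // dvdp_XsubCl.
  by have := ode_mup g0 sg ode g1' z0; rewrite mua; lia.
- by case: m0; rewrite mua => m0; [exists 0%N | exists 1%N]; lia.
have sga : (size g).-1 = (2 * (size a).-1)%N.
  by rewrite aE size_exp mulnC.
move: dP; rewrite {}sga; move: (size a).-1 => s.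
by case=> dP; [exists 0%N | exists 1%N]; lia.
Qed.
End HasseRoot.

(** * Polynomials in xi as modular forms *)

Section LinearODE.
Variable K : fieldType.
Implicit Types a g : {poly K}.

Definition lin_ode a : {poly K} :=
  144 * 'X ^+ 2 * ('X - 1) * a^`()^`() + 144 * 'X * (2 * 'X - 1) * a^`()
  + (27 * 'X + 4) * a.

Lemma hasse_ode_sqr a : hasse_ode (a ^+ 2) = a ^+ 3 * lin_ode a.
Proof.
have d1 : (a ^+ 2)^`() = 2 * a * a^`() by rewrite expr2 derivM; ring.
have d2 : (2 * a * a^`())^`() = 2 * a^`() ^+ 2 + 2 * a * a^`()^`().
  have -> : 2 * a * a^`() = a * a^`() + a * a^`() by ring.
  by rewrite derivD !derivM; ring.
rewrite /hasse_ode /lin_ode d1 d2; ring.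
Qed.
End LinearODE.

Section Support.
Variable K : fieldType.
Implicit Types (f g : {poly K}).

(** In weight 2i the monomial X^p stands for E4^(3p - i) E6^(i - 2p); the
    condition says that g represents a form divisible by E4^u E6^v. *)
Definition supp (i u v : nat) g :=
  forall p, g`_p != 0 -> ((i + u <= 3 * p) && (2 * p + v <= i))%N.

Lemma coef_natM k g p : (k%:R * g)`_p = k%:R * g`_p.
Proof. by rewrite mulr_natl coefMn mulr_natl. Qed.

Lemma suppD i u v f g : supp i u v f -> supp i u v g -> supp i u v (f + g).
Proof.
move=> sf sg p; rewrite coefD; case: (eqVneq f`_p 0) => [->|/sf //].
by rewrite add0r => /sg.
Qed.

Lemma supp_nat i u v k f : supp i u v f -> supp i u v (k%:R * f).
Proof. by move=> sf p; rewrite coef_natM mulf_eq0 => /norP[_ /sf]. Qed.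

Lemma supp_nat_inv i u v k f : k%:R != 0 :> K ->
  supp i u v (k%:R * f) -> supp i u v f.
Proof. by move=> k0 sf p fp; apply: sf; rewrite coef_natM mulf_neq0. Qed.

Lemma suppM i u v f j u' v' g : supp i u v f -> supp j u' v' g ->
  supp (i + j) (u + u') (v + v') (f * g).
Proof.
move=> sf sg p; apply: contraNT => np; apply/eqP; rewrite coefM big1 // => k _.
case: (eqVneq f`_k 0) => [->|/sf fk]; first by rewrite mul0r.
case: (eqVneq g`_(p - k) 0) => [->|/sg gk]; first by rewrite mulr0.
by move: np fk gk (ltn_ord k); lia.
Qed.

Lemma supp1 : supp 0 0 0 1.
Proof. by move=> p; rewrite coef1; case: p => //= p; rewrite eqxx. Qed.

Lemma suppX i u v g r : supp i u v g -> supp (i * r) (u * r) (v * r) (g ^+ r).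
Proof.
move=> sg; elim: r => [|r IH]; first by rewrite !muln0; apply: supp1.
by rewrite exprS !mulnS; apply: suppM.
Qed.

Lemma supp_Xn s t : supp (2 * s + 3 * t) s t 'X^(s + t).
Proof. by move=> p; rewrite coefXn; case: (p =P _) => [->|]; rewrite ?eqxx //; lia. Qed.

Lemma suppW i u v u' v' g : (u' <= u)%N -> (v' <= v)%N -> supp i u v g -> supp i u' v' g.
Proof. by move=> uu vv sg p /sg; lia. Qed.

(** Twelve times the Serre derivative theta - (2i / 12) E2 on forms of weight
    2i; E2 cancels, and the result has weight 2i + 2. *)
Definition serre i g : {poly K} :=
  12 * ('X * ('X - 1)) * g^`() - i%:R * (6 * 'X - 4) * g.

(** The Serre derivative sends E4 to a multiple of E6 and E6 to a multiple of
    E4^2, so each exponent drops by at most one. An exponent that is already 0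
    stays nonnegative because the coefficient of the offending monomial
    vanishes. *)
Lemma supp_serre i u v g : supp i u v g -> supp i.+1 u.-1 v.-1 (serre i g).
Proof.
move=> sg p.
have -> : serre i g = 'X * (12 * ('X * g^`()) - 6 * (i%:R * g))
   - (12 * ('X * g^`()) - 4 * (i%:R * g)) by rewrite /serre; ring.
have cE q j : (12 * ('X * g^`()) - j%:R * (i%:R * g))`_q =
    (12 * q%:R - j%:R * i%:R) * g`_q.
  by rewrite coefB !coef_natM coef_euler; ring.
rewrite coefB coefXM !cE; case: p => [|p] /=.
  rewrite sub0r oppr_eq0 mulf_eq0 => /norP[c0 /sg].
  rewrite mulr0 sub0r oppr_eq0 -natrM in c0.
  have: i != 0%N by apply: contraNneq c0 => ->; rewrite muln0.
  by lia.
case: (eqVneq ((12 * p%:R - 6%:R * i%:R) * g`_p) 0) => [->|].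
  rewrite sub0r oppr_eq0 mulf_eq0 => /norP[c0 gp].
  have: i != (3 * p.+1)%N.
    apply: contraNneq c0 => ->; rewrite -!natrM subr_eq0; apply/eqP; congr _%:R; lia.
  by have := sg _ gp; lia.
rewrite mulf_eq0 => /norP[c0 /sg gp] _.
have: i != (2 * p)%N.
  apply: contraNneq c0 => ->; rewrite -!natrM subr_eq0; apply/eqP; congr _%:R; lia.
by move: gp; lia.
Qed.

(** The valence formula: the order at 0 is at least (i + u) / 3 and the degree
    at most (i - v) / 2, which leaves room for (i - 2 u - 3 v) / 6 zeros
    elsewhere. *)
Lemma supp_count i u v g e (rs : seq K) : supp i u v g -> g != 0 ->
    uniq rs -> 0 \notin rs -> (forall z, z \in rs -> ('X - z%:P) ^+ e %| g) ->
  (6 * (e * size rs) + 2 * u + 3 * v <= i)%N.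
Proof.
move=> sg g0 urs rs0 dvd.
have [m [q qz gE]] := multiplicity_XsubC g 0; rewrite g0 /= in qz.
move: gE; rewrite subr0 => gE.
have q0 : q != 0 by apply: contraNneq qz => ->; rewrite root0.
have sm : (i + u <= 3 * m)%N.
  have /sg : g`_m != 0.
    by rewrite gE coefMXn ltnn subnn -horner_coef0.
  by case/andP.
have sd : (2 * (size g).-1 + v <= i)%N.
  have /sg : g`_(size g).-1 != 0 by rewrite -lead_coefE lead_coef_eq0.
  by case/andP.
have dq : \prod_(z <- rs) ('X - z%:P) ^+ e %| q.
  elim: rs urs rs0 dvd => [|z rs IH] /=; first by rewrite big_nil dvd1p.
  case/andP=> zrs urs; rewrite inE negb_or => /andP[z0 rs0] dvd.
  rewrite big_cons Gauss_dvdp.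
    rewrite IH // => [|x xrs]; last by apply: dvd; rewrite inE xrs orbT.
    rewrite andbT; have := dvd z (mem_head _ _); rewrite gE Gauss_dvdpl //.
    rewrite coprimep_expl // coprimep_expr //.
    by rewrite coprimep_sym coprimep_XsubC rootX eq_sym.
  rewrite coprimep_expl //.
  elim: rs zrs {urs rs0 dvd IH} => [|x rs IH]; first by rewrite big_nil coprimep1.
  rewrite inE negb_or big_cons coprimepMr => /andP[zx /IH ->]; rewrite andbT.
  by rewrite coprimep_expr // coprimep_XsubC root_XsubC eq_sym.
have sq : (e * size rs < size q)%N.
  rewrite prodrXl in dq; set P := \prod_(z <- rs) _ in dq.
  have P0 : P ^+ e != 0 by rewrite expf_neq0 // monic_neq0 // monic_prod_XsubC.
  have := dvdp_leq q0 dq; have := size_exp P e; rewrite /P size_prod_XsubC /= -/P.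
  by move: P0; rewrite -size_poly_gt0 mulnC; case: (size (P ^+ e)) => // k _ /= ->.
have sgE : size g = (size q + m)%N by rewrite gE size_mulXn // addnC.
by move: sm sd sq; rewrite sgE; move: (e * _)%N (size q) => ? ?; lia.
Qed.
End Support.

Section Forms.
Variables (K : fieldType) (l n : nat).
Hypothesis l_char : l \in [pchar K].
Hypothesis l_gt3 : (3 < l)%N.
Hypothesis ln : l = n.*2.+1.
Implicit Types (f g : {poly K}).
Variable a : {poly K}.

(** The polynomial of E2, as a form of weight l + 1; see [sqrt_hasse_P]. *)
Definition hasse_b : {poly K} := 12 * ('X * ('X - 1)) * a^`() + (3 * 'X - 2) * a.
(** The polynomial of theta (g(xi) nu^i), a form whose weight is larger by
    l + 1; see [theta_wtheta]. *)
Definition wtheta i g : {poly K} := 'X * ('X - 1) * (a * g^`() + (2 * i)%:R * a^`() * g).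

(** The weight l - 1 of the Hasse invariant is -1 modulo l. *)
Lemma pchar_2n1 : 2 * n%:R + 1 = 0 :> {poly K}.
Proof.
rewrite -natrM mul2n -(natrD _ _ 1) addn1 -ln -(rmorph_nat (@polyC K)).
by rewrite (pcharf0 l_char).
Qed.

(** E2 is a multiple of the logarithmic derivative of the Hasse invariant, so
    over the latter it is its Serre derivative. *)
Lemma hasse_bE : hasse_b = serre n a.
Proof.
have e : 2 * n%:R = -1 :> {poly K} by rewrite -[RHS]add0r -pchar_2n1 addrK.
rewrite /hasse_b /serre; transitivity (12 * ('X * ('X - 1)) * a^`()
   - (2 * n%:R) * (3 * 'X - 2) * a); last ring.
by rewrite e; ring.
Qed.

Lemma wtheta_serre i g : 12 * wtheta i g = a * serre i g + (2 * i)%:R * (hasse_b * g).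
Proof. rewrite /wtheta /serre /hasse_b natrM; ring. Qed.

(** Up to a factor, theta is the Serre derivative times a, plus E2 times the
    form. The Serre derivative may lose a factor E4 or E6; when ua or va is 1,
    the factor a of weight l - 1 gives it back. *)
Lemma supp_wtheta ua va i u v g : supp n ua va a ->
    (ua = 1 \/ u = 0)%N -> (va = 1 \/ v = 0)%N ->
  supp i u v g -> supp (i + n.+1) u v (wtheta i g).
Proof.
move=> sa hu hv sg.
apply: (@supp_nat_inv _ _ _ _ 12); first exact: (pow23_neq0 l_char l_gt3 2 1).
rewrite wtheta_serre; apply: suppD.
  have -> : (i + n.+1 = n + i.+1)%N by lia.
  by apply: suppW (suppM sa (supp_serre sg)); lia.
apply: supp_nat; rewrite hasse_bE addnC.
by apply: suppW (suppM (supp_serre sa) sg); lia.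
Qed.

Fixpoint iter_wtheta i g j : {poly K} :=
  if j is m.+1 then wtheta (i + m * n.+1) (iter_wtheta i g m) else g.

Lemma iter_wtheta0 i g j m : (j <= m)%N -> iter_wtheta i g j = 0 -> iter_wtheta i g m = 0.
Proof.
move=> jm g0; rewrite -(subnK jm); elim: (m - j)%N => [//|d IH] /=.
by rewrite IH /wtheta deriv0 !mulr0 addr0 mulr0.
Qed.

Lemma supp_iter_wtheta ua va i u v g j : supp n ua va a ->
    (ua = 1 \/ u = 0)%N -> (va = 1 \/ v = 0)%N ->
  supp i u v g -> supp (i + j * n.+1) u v (iter_wtheta i g j).
Proof.
move=> sa hu hv sg; elim: j => [|j IH] /=; first by rewrite mul0n addn0.
by rewrite mulSn addnCA addnC; apply: supp_wtheta sa hu hv IH.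
Qed.

(** * Orders of vanishing at a zero of the Hasse invariant *)

Section Local.
Variables (z : K) (a1 : {poly K}).
Hypothesis z0 : z != 0.
Hypothesis z1 : z != 1.
Hypothesis aE : a = ('X - z%:P) * a1.
Hypothesis a1z : a1.[z] != 0.

Definition has_order v g := exists2 u : {poly K}, u.[z] != 0 & g = ('X - z%:P) ^+ v * u.

Lemma has_order_neq0 v g : has_order v g -> g != 0.
Proof.
case=> u uz ->; rewrite mulf_neq0 ?expf_neq0 ?polyXsubC_eq0 //.
by apply: contraNneq uz => ->; rewrite horner0.
Qed.

Lemma has_order_max v w g : has_order v g -> ('X - z%:P) ^+ w %| g -> (w <= v)%N.
Proof.
case=> u uz -> /dvdpP [q E]; rewrite leqNgt; apply/negP => vw.
have y0 : ('X - z%:P) ^+ v != 0 by rewrite expf_neq0 // polyXsubC_eq0.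
move: E uz; rewrite -(subnK (ltnW vw)) exprD mulrA mulrC => /(mulIf y0) ->.
by rewrite hornerM horner_exp hornerXsubC subrr expr0n subn_eq0 leqNgt vw mulr0 eqxx.
Qed.

Lemma root_deriv : (a^`()).[z] = a1.[z].
Proof. by rewrite aE derivM derivXsubC mul1r hornerD hornerM hornerXsubC subrr mul0r addr0. Qed.

Lemma hasse_b_root : hasse_b.[z] = 12 * (z * (z - 1)) * a1.[z].
Proof. by rewrite /hasse_b !evalE root_deriv aE !evalE subrr mul0r mulr0 addr0. Qed.

Lemma hasse_b_root_neq0 : hasse_b.[z] != 0.
Proof.
rewrite hasse_b_root !mulf_neq0 ?subr_eq0 //.
exact: (pow23_neq0 l_char l_gt3 2 1).
Qed.

(** At a zero of a, the value of hasse_b is a nonzero multiple of the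
    derivative of a. *)
Lemma has_order_monomial r m : has_order 0 (hasse_b ^+ r * 'X^m).
Proof.
exists (hasse_b ^+ r * 'X^m); last by rewrite mul1r.
by rewrite hornerM horner_exp hornerXn mulf_neq0 // expf_neq0 // hasse_b_root_neq0.
Qed.

(** Near z the leading coefficient is multiplied by (v + 2i) a'(z), up to the
    factor z (z - 1). *)
Lemma wtheta_order i v g : has_order v g -> (v + 2 * i)%:R != 0 :> K ->
  has_order v (wtheta i g).
Proof.
case=> u uz gE c0; exists ('X * ('X - 1) *
  (a1 * (v%:R * u + ('X - z%:P) * u^`()) + (2 * i)%:R * a^`() * u)).
  rewrite !evalE root_deriv subrr mul0r addr0.
  have -> : a1.[z] * (v%:R * u.[z]) + (2 * i)%:R * a1.[z] * u.[z] =
      a1.[z] * u.[z] * (v + 2 * i)%:R by rewrite natrD; ring.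
  by rewrite !mulf_eq0 subr_eq0 !negb_or z0 z1 a1z uz c0.
have e := euler_mul z v u; rewrite /wtheta {1}aE gE.
transitivity ('X * ('X - 1) * (a1 * (('X - z%:P) * (('X - z%:P) ^+ v * u)^`())
  + (2 * i)%:R * a^`() * (('X - z%:P) ^+ v * u))); first ring.
rewrite e; ring.
Qed.

(** As 2 (n + 1) = l + 1, each step raises 2i by 1 modulo l. *)
Lemma iter_wtheta_order i g v j m : (j <= m)%N -> has_order v (iter_wtheta i g j) ->
    (forall k, (j <= k < m)%N -> ~~ (l %| v + (2 * i + k))%N) ->
  has_order v (iter_wtheta i g m).
Proof.
move=> jm; rewrite -(subnK jm); elim: (m - j)%N => [//|d IH] Hj Hk /=.
apply: wtheta_order; first by apply: IH => // k kd; apply: Hk; lia.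
rewrite (natr_pchar_eq0 l_char); have := Hk (d + j)%N; rewrite leq_addl ltnSn => /(_ isT) Hd.
have -> : (v + 2 * (i + (d + j) * n.+1) = v + (2 * i + (d + j)) + l * (d + j))%N.
  by rewrite ln; lia.
by rewrite dvdn_addl // dvdn_mulr.
Qed.

Lemma dvd_relation i g c : iter_wtheta i g n.+1 = c%:P * a ^+ n.+1 * iter_wtheta i g 1 ->
  ('X - z%:P) ^+ n.+1 %| iter_wtheta i g n.+1.
Proof.
by move=> ->; rewrite mulrAC dvdp_mull // aE exprMn dvdp_mulr.
Qed.

(** The order at z starts at 0 and cannot change, while the right-hand side
    vanishes at z. *)
Lemma relation_pos i g c k : iter_wtheta i g n.+1 = c%:P * a ^+ n.+1 * iter_wtheta i g 1 ->
    has_order 0 g -> (0 < k)%N -> (k + n < l)%N -> ((2 * i)%:R = k%:R :> K) ->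
  False.
Proof.
move=> rel g0 k0 kn ik.
suff /has_order_max/(_ (dvd_relation rel)) : has_order 0 (iter_wtheta i g n.+1) by [].
apply: (@iter_wtheta_order _ _ _ 0) => // j jn.
rewrite add0n -(natr_pchar_eq0 l_char) natrD ik -natrD (natr_pchar_eq0 l_char).
by apply/negP => /dvdn_leq; lia.
Qed.

(** From the index J on, the order v plus the weight runs through 1 + v,
    2 + v, ..., which stays below l as long as v <= n. So an order at most n
    would persist up to the index n + 1, where it is at least n + 1. *)
Lemma relation_neg i g c J : iter_wtheta i g n.+1 = c%:P * a ^+ n.+1 * iter_wtheta i g 1 ->
    (0 < J <= n.+1)%N -> ((2 * i + J)%:R = 1 :> K) ->
  ('X - z%:P) ^+ n.+1 %| iter_wtheta i g J.
Proof.
move=> rel /andP[J0 Jn] iJ; case: (eqVneq (iter_wtheta i g J) 0) => [->|gJ].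
  exact: dvdp0.
have [v [u]] := multiplicity_XsubC (iter_wtheta i g J) z; rewrite gJ /= => uz E.
have Ov : has_order v (iter_wtheta i g J) by exists u; rewrite // E mulrC.
case: (leqP n.+1 v) => vn.
  by rewrite E dvdp_mull // dvdp_exp2l.
have /has_order_max/(_ (dvd_relation rel)) : has_order v (iter_wtheta i g n.+1).
  apply: iter_wtheta_order Ov _ => // j /andP[Jj jn].
  have -> : (v + (2 * i + j) = (2 * i + J) + (v + (j - J)))%N by lia.
  rewrite -(natr_pchar_eq0 l_char) natrD iJ -(natrD _ 1) (natr_pchar_eq0 l_char).
  by apply/negP => /dvdn_leq; lia.
by rewrite leqNgt vn.
Qed.

(** In weight 0 the operator is a multiple of the derivative, so the
    derivative of hasse_b^r * X^m vanishes at z. The linear equation of a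
    gives the logarithmic derivative of hasse_b at z. *)
Lemma relation_zero i r m c :
    iter_wtheta i (hasse_b ^+ r * 'X^m) n.+1 =
      c%:P * a ^+ n.+1 * iter_wtheta i (hasse_b ^+ r * 'X^m) 1 ->
    (0 < n)%N -> lin_ode a = 0 -> ((2 * i)%:R = 0 :> K) ->
  r%:R * (3 * z - 2) + 12 * m%:R * (z - 1) = 0.
Proof.
move=> rel n0 ode i0; set g := hasse_b ^+ r * 'X^m in rel *.
have /dvdpP[q] : ('X - z%:P) ^+ n.+1 %| iter_wtheta i g 1.
  by apply: (relation_neg rel); rewrite // natrD i0 add0r.
have i0P : (2 * i)%:R = 0 :> {poly K} by rewrite -(rmorph_nat (@polyC K)) i0.
rewrite /= mul0n addn0 /wtheta i0P !mul0r addr0 {1}aE exprSr.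
rewrite mulrA => E.
have {}E : 'X * ('X - 1) * (a1 * g^`()) = q * ('X - z%:P) ^+ n.
  apply: (@mulIf _ ('X - z%:P)); rewrite ?polyXsubC_eq0 // -[RHS]mulrA -E; ring.
move/(congr1 (horner^~ z)): E; rewrite !evalE subrr [in RHS]expr0n (gtn_eqF n0) mulr0.
move/eqP; rewrite !mulf_eq0 subr_eq0 (negbTE z0) (negbTE z1) (negbTE a1z) /= => /eqP gz.
have bz := hasse_b_root; have bz0 := hasse_b_root_neq0.
have az : a.[z] = 0 by rewrite aE !evalE subrr mul0r.
have dbz : hasse_b^`().[z] = (3 * z - 2) * a1.[z].
  have dbE : hasse_b^`() = 12 * ('X * ('X - 1) * a^`()^`() + (2 * 'X - 1) * a^`())
      + 3 * a + (3 * 'X - 2) * a^`().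
    have dn k (p : {poly K}) : (k%:R * p)^`() = k%:R * p^`().
      by rewrite mulr_natl derivMn mulr_natl.
    have -> : hasse_b = 12 * ('X * ('X - 1) * a^`()) + 3 * ('X * a) - 2 * a.
      by rewrite /hasse_b; ring.
    by rewrite derivB derivD !dn !derivM derivB derivX derivC; ring.
  move/(congr1 (horner^~ z)): ode; rewrite dbE /lin_ode !evalE root_deriv az => E.
  suff -> : 12 * (z * (z - 1) * a^`()^`().[z] + (2 * z - 1) * a1.[z]) = 0 by ring.
  apply/eqP; have := pow23_neq0 l_char l_gt3 2 1 => c0.
  rewrite -(mulIr_eq0 _ (mulIf (mulf_neq0 c0 z0))); apply/eqP; rewrite -[RHS]E; ring.
have gE : hasse_b * 'X * g^`() = g * (r%:R * hasse_b^`() * 'X + m%:R * hasse_b).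
  rewrite derivM; transitivity (hasse_b * (hasse_b ^+ r)^`() * ('X * 'X^m)
     + 'X * ('X^m)^`() * (hasse_b * hasse_b ^+ r)); first ring.
  have -> : 'X * ('X^m)^`() = m%:R * 'X^m :> {poly K}.
    rewrite derivXn mulrnAr; case: (m) => [|m'] /=; first by rewrite mul0r mulr0n.
    by rewrite -exprS mulr_natl.
  have -> : hasse_b * (hasse_b ^+ r)^`() = r%:R * hasse_b ^+ r * hasse_b^`().
    rewrite deriv_exp mulrnAr; case: (r) => [|r'] /=; first by rewrite !mul0r mulr0n.
    by rewrite exprS -mulr_natl; ring.
  by rewrite /g; ring.
have c12 : 12 != 0 :> K := pow23_neq0 l_char l_gt3 2 1.
move: hasse_b @g {rel} bz bz0 dbz gE gz => b g bz bz0 dbz gE gz.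
have gz0 : g.[z] != 0 by rewrite /g !evalE mulf_neq0 ?expf_neq0.
clearbody g; move/(congr1 (horner^~ z)): gE; rewrite !evalE gz mulr0 => /esym/eqP.
rewrite mulf_eq0 (negbTE gz0) /= dbz bz => /eqP E.
by apply: (mulIf (mulf_neq0 z0 a1z)); rewrite mul0r -[RHS]E; ring.
Qed.
End Local.

End Forms.

(** * Evaluation at the series xi *)

Section Ev.
Variables (K : fieldType) (xi : fps K).
Hypothesis xi0 : xi 0%N = 1.
Hypothesis xi1 : xi != 1.

Definition ev : {poly K} -> fps K := horner_eval xi \o map_poly (@fpsC K).
HB.instance Definition _ := GRing.RMorphism.on ev.

Lemma evC c : ev c%:P = fpsC c.
Proof. by rewrite /ev /= map_polyC /= /horner_eval hornerC. Qed.

Lemma evX : ev 'X = xi.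
Proof. by rewrite /ev /= map_polyX /horner_eval hornerX. Qed.

Lemma evM f g : ev (f * g) = ev f * ev g. Proof. exact: rmorphM. Qed.
Lemma evD f g : ev (f + g) = ev f + ev g. Proof. exact: rmorphD. Qed.
Lemma evB f g : ev (f - g) = ev f - ev g. Proof. exact: rmorphB. Qed.
Lemma evXn f k : ev (f ^+ k) = ev f ^+ k. Proof. exact: rmorphXn. Qed.
Lemma evn k : ev k%:R = k%:R. Proof. exact: rmorph_nat. Qed.
Lemma ev1 : ev 1 = 1. Proof. exact: rmorph1. Qed.
Definition evE := (ev1, evn, evX, evB, evD, evXn, evM).

Lemma theta_ev g : theta (ev g) = ev g^`() * theta xi.
Proof.
elim/poly_ind: g => [|p c IH]; first by rewrite deriv0 !rmorph0 raddf0 mul0r.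
rewrite derivD derivM derivX derivC addr0 mulr1 !rmorphD !rmorphM /= evX evC.
by rewrite raddfD /= thetaM thetaC addr0 IH; ring.
Qed.

Lemma coef0_fpsX (f : fps K) k : (f ^+ k) 0%N = f 0%N ^+ k.
Proof. by elim: k => [|k IH] //; rewrite !exprS coef0_fpsM IH. Qed.

Lemma ev_coef0 g : ev g 0%N = g.[1].
Proof.
elim/poly_ind: g => [|p c IH]; first by rewrite rmorph0 horner0.
have -> : ev (p * 'X + c%:P) = ev p * xi + fpsC c.
  by rewrite rmorphD rmorphM /= evX evC.
by rewrite coef_fpsD coef0_fpsM IH xi0 hornerMXaddC /= mul1r.
Qed.

(** The series xi - 1 is nonzero without constant term. Writing g =
    (X - 1)^m q with q(1) nonzero, no factor of the value of g vanishes. *)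
Lemma ev_inj : injective ev.
Proof.
apply: raddf_inj => g /eqP evg; apply/eqP; apply: contraLR evg => g0.
have [m [q]] := multiplicity_XsubC g 1; rewrite g0 /= => q1 ->.
rewrite rmorphM rmorphXn rmorphB rmorph1 /= evX mulf_neq0 //.
  by apply: contraNneq q1 => e; rewrite /root -ev_coef0 e.
by rewrite expf_neq0 // subr_eq0.
Qed.
End Ev.

(** * Iterated derivatives of xi and the Hasse invariant *)

Section Zagier.
Variable K : fieldType.
Variable l : nat.
Hypothesis l_char : l \in [pchar K].
Hypothesis l_gt3 : (3 < l)%N.

Let L : {poly K} := 'X * ('X - 1).

(** Two consecutive terms, because the recursion has order two. *)
Fixpoint zagier2 j : {poly K} * {poly K} :=
  if j is i.+1 then
    let: (p, q) := zagier2 i in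
    (q, L * q^`() - (i.+1)%:R * ((2^-1)%:P * 'X - (3^-1)%:P) * q
        - (i.+1 * i)%:R * ((144^-1)%:P * 'X) * p)
  else ('X, L).
(** Zagier's modified derivatives: zagier j is the polynomial of the part of
    theta^j xi that does not involve E2; see [iter_theta_xi]. *)
Definition zagier j := (zagier2 j).1.

Lemma zagier0 : zagier 0 = 'X. Proof. by []. Qed.
Lemma zagierS j : zagier j.+1 = (zagier2 j).2.
Proof. by rewrite /zagier /=; case: zagier2. Qed.

Lemma zagier_rec j : zagier j.+1 = L * (zagier j)^`()
   - j%:R * ((2^-1)%:P * 'X - (3^-1)%:P) * zagier j
   - (j * j.-1)%:R * ((144^-1)%:P * 'X) * zagier j.-1.
Proof.
case: j => [|j]; first by rewrite zagierS /= zagier0 derivX !mul0r !subr0 mulr1.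
by rewrite zagierS /= /zagier /=; case: zagier2.
Qed.

Lemma dvdp_zagier j : L %| zagier j.+1.
Proof.
elim/ltn_ind: j => -[|j] IH.
  by rewrite zagier_rec zagier0 derivX !mul0r !subr0 mulr1.
rewrite zagier_rec; apply: dvdp_sub; first apply: dvdp_sub.
- exact: dvdp_mulr.
- by rewrite dvdp_mull // IH.
case: j IH => [|j] IH /=; first by rewrite muln0 !mul0r dvdp0.
by rewrite dvdp_mull // IH.
Qed.

Lemma size_zagier j : (size (zagier j) <= j.+2)%N.
Proof.
have szX (p : {poly K}) (c : K) k : (size p <= k)%N -> (size (c%:P * 'X * p)%R <= k.+1)%N.
  move=> sp; rewrite -mulrA mul_polyC (leq_trans (size_scale_leq _ _)) //.
  by rewrite mulrC (leq_trans (size_polyMleq _ _)) // size_polyX; lia.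
have szN (p : {poly K}) c k : (size p <= k)%N -> (size (c%:R * p)%R <= k)%N.
  by move=> sp; rewrite -(rmorph_nat (@polyC K)) mul_polyC (leq_trans (size_scale_leq _ _)).
have szB (p q : {poly K}) k : (size p <= k)%N -> (size q <= k)%N -> (size (p - q)%R <= k)%N.
  by move=> sp sq; rewrite (leq_trans (size_polyD _ _)) // size_polyN geq_max sp.
elim/ltn_ind: j => -[|j] IH; first by rewrite size_polyX.
have IHj := IH j (ltnSn j).
rewrite zagier_rec; apply: (szB); first apply: (szB).
- case: (eqVneq (zagier j)^`() 0) => [->|d0]; first by rewrite mulr0 size_poly0.
  have sd : (size (zagier j)^`() < j.+2)%N.
    apply: leq_trans IHj; apply: lt_size_deriv.
    by apply: contraNneq d0 => ->; rewrite deriv0.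
  apply: leq_trans (size_polyMleq _ _) _.
  have : (size L <= 3)%N.
    apply: leq_trans (size_polyMleq _ _) _.
    by rewrite size_polyX -(rmorph1 (@polyC K)) size_XsubC.
  by move: sd; move: (size L) (size _^`()) => ? ?; lia.
- rewrite -mulrA; apply: (szN); rewrite mulrBl; apply: (szB); first exact: szX.
  by rewrite mul_polyC (leq_trans (size_scale_leq _ _)) // ltnW.
case: j IH {IHj} => [|j] IH /=; first by rewrite muln0 !mul0r size_poly0.
rewrite -mulrA; apply: (szN); apply: ltnW; apply: szX; apply: IH; lia.
Qed.

(** The coefficient of (E2 / 12)^e in the j-th derivative of a form of weight
    0. *)
Definition zcoef j e := ('C(j, e) * j.-1 ^_ e)%N.

Lemma zcoefS j e : (e <= j)%N -> zcoef j.+1 e.+1 = (zcoef j e.+1 + (2 * j - e) * zcoef j e)%N.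
Proof.
rewrite /zcoef /=; case: j => [|j]; first by case: e.
rewrite /= binS ffactSS ffactnSr => ej.
have E := mul_bin_left j.+1 e.
case: (ltngtP e j.+1) ej => // [ej|->] _; last by rewrite ffact_small //= !muln0.
move: E; rewrite -(subnKC (ej : (e <= j)%N)) addKn; move: (j - e)%N => d.
move: 'C(_, _) 'C(_, _) (_ ^_ _) => B0 B1 F.
rewrite subSn ?leq_addr // addKn => E.
have {}E : ((B1 + B0) * (e + d).+1 = B1 * d + (2 * (e + d).+1 - e) * B0)%N by nia.
by rewrite mulnA E; nia.
Qed.

Lemma zcoef_mul j e : (zcoef j e.+1 * e.+1 = zcoef j e * ((j - e) * (j - e).-1))%N.
Proof.
rewrite /zcoef ffactnSr; have := mul_bin_left j e => E.
have -> : (j - e).-1 = (j.-1 - e)%N by lia.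
move: ('C(j, e.+1)) ('C(j, e)) (j.-1 ^_ e) (j.-1 - e)%N (j - e)%N E => C1 C0 F d d' E.
have -> : (C1 * (F * d) * e.+1 = e.+1 * C1 * (F * d))%N by lia.
rewrite E; lia.
Qed.

Variables (P xi nu : fps K).
Hypothesis Hxi : theta xi = nu * xi * (xi - 1).
Hypothesis Hnu : 6 * theta nu = nu * (P - 3 * xi * nu + 2 * nu).
Hypothesis HP : 12 * theta P = P ^+ 2 - xi * nu ^+ 2.

Local Notation evx := (ev xi).
Let w : fps K := fpsC 12^-1 * P.

Lemma fpsC_nat_inv k (f : fps K) : k%:R != 0 :> K -> k%:R * (fpsC k%:R^-1 * f) = f.
Proof.
by move=> k0; rewrite mulrA -(rmorph_nat (@fpsC K)) -rmorphM mulfV // rmorph1 mul1r.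
Qed.

Lemma nat_mulI k : k%:R != 0 :> K -> injective (fun f : fps K => k%:R * f).
Proof. by move=> k0; apply: mulfI; rewrite -(rmorph_nat (@fpsC K)) fmorph_eq0. Qed.

(** Ramanujan's equation for w = E2 / 12. *)
Lemma theta_w : theta w = w ^+ 2 - fpsC 144^-1 * (xi * nu ^+ 2).
Proof.
have c12 : 12 != 0 :> K := pow23_neq0 l_char l_gt3 2 1.
have c144 : 144 != 0 :> K := pow23_neq0 l_char l_gt3 4 2.
apply: (@nat_mulI 144) => //=; rewrite mulrBr fpsC_nat_inv // /w thetaM thetaC mul0r add0r.
transitivity (12 * (12 * (fpsC 12^-1 * theta P))); first ring.
rewrite fpsC_nat_inv // HP; congr (_ - _).
rewrite -{1}(fpsC_nat_inv P c12); ring.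
Qed.

Let p i : fps K := evx (zagier i).
Let h : fps K := fpsC 2^-1 * xi - fpsC 3^-1.
Let c : fps K := fpsC 144^-1 * xi.

Lemma theta_nu : theta nu = nu * (2 * w - nu * h).
Proof.
have c12 : 12 != 0 :> K := pow23_neq0 l_char l_gt3 2 1.
have c2 : 2 != 0 :> K := pow23_neq0 l_char l_gt3 1 0.
have c3 : 3 != 0 :> K := pow23_neq0 l_char l_gt3 0 1.
have c6 : 6 != 0 :> K := pow23_neq0 l_char l_gt3 1 1.
apply: (@nat_mulI 6) => //=; rewrite Hnu.
transitivity (nu * (12 * w - nu * (3 * (2 * (fpsC 2^-1 * xi)) - 2 * (3 * (fpsC 3^-1 * 1))))).
  by rewrite /w !fpsC_nat_inv //; ring.
rewrite /h; ring.
Qed.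

Lemma theta_p i : theta (p i) =
  nu * (p i.+1 + i%:R * h * p i + (i * i.-1)%:R * c * p i.-1).
Proof.
rewrite /p theta_ev Hxi zagier_rec.
rewrite !(rmorphB, rmorphM, rmorph_nat) /= !(evX, evC, rmorph1) /h /c; ring.
Qed.

Lemma theta_term e i : theta (w ^+ e * nu ^+ i * p i) =
  (e + 2 * i)%:R * (w ^+ e.+1 * nu ^+ i * p i) + w ^+ e * nu ^+ i.+1 * p i.+1
  + (i * i.-1)%:R * (c * w ^+ e * nu ^+ i.+1 * p i.-1)
  - e%:R * (c * w ^+ e.-1 * nu ^+ i.+2 * p i).
Proof.
have Ew : theta (w ^+ e) = e%:R * w ^+ e.+1 - e%:R * (c * w ^+ e.-1 * nu ^+ 2).
  rewrite thetaX theta_w /c; case: e => [|e] /=; first by ring.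
  by rewrite !exprS; ring.
have Enu : theta (nu ^+ i) = i%:R * nu ^+ i * (2 * w - nu * h).
  rewrite thetaX theta_nu; case: i => [|i] /=; first by rewrite !mul0r.
  by rewrite exprS; ring.
rewrite !thetaM Ew Enu theta_p natrD (natrM _ 2) !exprS; ring.
Qed.

(** By induction on j. Under theta a term gains a factor w, keeps w, or loses
    w; the losses from one term cancel against the second order part of the
    recursion for the previous one, and the gains add up to zcoef. *)
Lemma iter_theta_xi j : iter j (@theta K) xi =
  \sum_(e < j.+1) (zcoef j e)%:R * (w ^+ e * nu ^+ (j - e) * p (j - e)).
Proof.
elim: j => [|j IH].
  by rewrite big_ord1 /zcoef /= !mul1r /p evX.
rewrite iterS IH raddf_sum /=.
have tn k f : theta (k%:R * f : fps K) = k%:R * theta f.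
  by rewrite thetaM theta_nat mul0r add0r.
pose A e := (zcoef j e)%:R * ((2 * j - e)%:R * (w ^+ e.+1 * nu ^+ (j - e) * p (j - e))).
pose B e := (zcoef j e)%:R * (w ^+ e * nu ^+ (j.+1 - e) * p (j.+1 - e)).
pose C e := (zcoef j e * ((j - e) * (j - e).-1))%:R *
  (c * w ^+ e * nu ^+ (j - e).+1 * p (j - e).-1).
pose D e := (zcoef j e * e)%:R * (c * w ^+ e.-1 * nu ^+ (j - e).+2 * p (j - e)).
(* A raises the power of w; B keeps it; C comes from the term of zagier j.-1
   in the recursion and D from theta w. *)
transitivity (\sum_(e < j.+1) (A e + B e + C e - D e)).
  apply: eq_bigr => e _; have ej := leq_ord e; rewrite tn theta_term /A /B /C /D.
  rewrite subSn // !natrM (_ : (2 * j - e = e + 2 * (j - e))%N); first ring.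
  lia.
rewrite sumrB !big_split /=.
have -> : \sum_(e < j.+1) C e = \sum_(e < j.+1) D e.
  rewrite big_ord_recr [RHS]big_ord_recl /= {2}/C {1}/D subnn !muln0 !mul0r addr0 add0r.
  apply: eq_bigr => e _; rewrite /C /D /bump add1n zcoef_mul /=.
  have ej := ltn_ord e; have -> : (j - e = (j - e.+1).+1)%N by lia.
  by [].
rewrite addrK [RHS]big_ord_recl /= addrC big_ord_recl /= -addrA; congr (_ + _).
  by rewrite /B /zcoef !bin0.
rewrite [RHS](eq_bigr (fun e : 'I_j.+1 => B e.+1 + A e)) => [|e _]; last first.
  rewrite /bump add1n zcoefS ?leq_ord // /A /B subSS natrD natrM; ring.
rewrite big_split /=; congr (_ + _).
rewrite [RHS]big_ord_recr /= (_ : B j.+1 = 0) ?addr0; last first.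
  by rewrite /B /zcoef bin_small // mul0n mul0r.
by apply: eq_bigr => e _; rewrite /bump add1n.
Qed.

Lemma frobenius_natr m : m%:R ^+ l = m%:R :> K.
Proof. by have := pFrobenius_aut_nat l_char m; rewrite pFrobenius_autE. Qed.

(** Fermat's little theorem on the indices of the coefficients. *)
Lemma iter_theta_l (f : fps K) : iter l (@theta K) f = theta f.
Proof. by apply/fpsP => m; rewrite coef_iter_theta frobenius_natr. Qed.

(** In the expansion of theta^l xi every coefficient but the first is
    divisible by l, and theta^l = theta over the prime field. *)
Lemma zagier_l : nu ^+ l * p l = theta xi.
Proof.
rewrite -iter_theta_l iter_theta_xi big_ord_recl big1 ?addr0 => [|e _].
  by rewrite /zcoef bin0 ffactn0 !mul1r subn0.
have lp := pcharf_prime l_char.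
rewrite lift0 -(rmorph_nat (@fpsC K)) (_ : _%:R = 0) ?rmorph0 ?mul0r //.
apply/eqP; rewrite (natr_pchar_eq0 l_char) /zcoef.
have := ltn_ord e; rewrite leq_eqVlt => /predU1P[el|el].
  by rewrite ffact_small ?muln0 // el; case: (l) lp.
by rewrite dvdn_mulr // prime_dvd_bin.
Qed.

Hypothesis xi0 : xi 0%N = 1.
Hypothesis nu0 : nu 0%N = 1.
Hypothesis xi1 : xi != 1.

Definition hasse_sq := zagier l %/ L.

Lemma hasse_sqE : zagier l = L * hasse_sq.
Proof.
have l0 : (0 < l)%N by apply: leq_trans l_gt3.
by rewrite mulrC divpK // -(prednK l0) dvdp_zagier.
Qed.

Lemma size_hasse_sq : (size hasse_sq <= l)%N.
Proof.
have L3 : size L = 3%N.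
  rewrite /L -(rmorph1 (@polyC K)) size_monicM ?monicX ?polyXsubC_eq0 //.
  by rewrite size_polyX size_XsubC.
by rewrite size_divp -?size_poly_eq0 L3 // leq_subLR; apply: size_zagier.
Qed.

Lemma nu_neq0 : nu != 0.
Proof. by apply: contraTneq (oner_neq0 K) => n0; rewrite -nu0 n0 eqxx. Qed.

(** The factor theta xi cancels from [zagier_l]. *)
Lemma hasse_sq_q : evx hasse_sq * nu ^+ l.-1 = 1.
Proof.
have l0 : (0 < l)%N by apply: leq_trans l_gt3.
have xn0 : xi != 0 by apply: contraTneq (oner_neq0 K) => n0; rewrite -xi0 n0 eqxx.
have := zagier_l; rewrite Hxi /p hasse_sqE !rmorphM rmorphB /= rmorph1 evX.
have z0 : nu * xi * (xi - 1) != 0 by rewrite !mulf_neq0 ?subr_eq0 ?nu_neq0.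
move=> E; apply: (mulfI z0); rewrite mulr1 -[RHS]E -[in RHS](prednK l0) exprS; ring.
Qed.
End Zagier.

(** * Weight two: E2 as the logarithmic derivative of the Hasse invariant *)

Section Hasse.
Variables (K : fieldType) (l n : nat).
Hypothesis l_char : l \in [pchar K].
Hypothesis l_gt3 : (3 < l)%N.
Hypothesis ln : l = n.*2.+1.
Variables (P xi nu : fps K).
Hypothesis Hxi : theta xi = nu * xi * (xi - 1).
Hypothesis Hnu : 6 * theta nu = nu * (P - 3 * xi * nu + 2 * nu).
Hypothesis HP : 12 * theta P = P ^+ 2 - xi * nu ^+ 2.
Hypothesis xi0 : xi 0%N = 1.
Hypothesis nu0 : nu 0%N = 1.
Hypothesis xi1 : xi != 1.
Local Notation evx := (ev xi).
Local Notation L := ('X * ('X - 1) : {poly K}).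

Let nu_n0 : nu != 0 := nu_neq0 nu0.

Lemma pchar_fps k : (k%:R : fps K) = 0 <-> (l %| k)%N.
Proof.
rewrite -(natr_pchar_eq0 l_char) -(rmorph_nat (@fpsC K)); split=> [/eqP|/eqP ->].
  by rewrite fmorph_eq0.
by rewrite rmorph0.
Qed.

Lemma evL : evx L = xi * (xi - 1).
Proof. by rewrite !evE. Qed.

Lemma theta_evL g : theta (evx g) = nu * evx (L * g^`()).
Proof. by rewrite theta_ev Hxi evM evL; ring. Qed.

Section Weight.
Variables (g : {poly K}) (N : nat).
Hypothesis gq : evx g * nu ^+ N = 1.

Lemma ev_unit_neq0 : evx g != 0.
Proof. by apply/eqP => g0; move/eqP: gq; rewrite g0 mul0r eq_sym oner_eq0. Qed.

(** The derivative of g(xi) nu^N = 1. *)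
Lemma theta_weight : N%:R * evx g * theta nu = - (nu ^+ 2 * evx (L * g^`())).
Proof.
have := congr1 (@theta K) gq; rewrite thetaM theta_evL thetaX (theta_nat _ 1) => E.
apply: (mulIf (expf_neq0 N nu_n0)); apply/eqP; rewrite -subr_eq0 mulNr opprK; apply/eqP.
rewrite -[RHS](mulr0 nu) -E; case: (N) => [|m] /=; rewrite ?exprS; ring.
Qed.
End Weight.

(** The exponent l - 1 is -1 in K, so the derivative of the relation
    g(xi) nu^(l-1) = 1 gives theta nu, hence E2, in terms of g. *)
Lemma hasse_P g : evx g * nu ^+ l.-1 = 1 ->
  P * evx g = nu * evx (6 * (L * g^`()) + (3 * 'X - 2) * g).
Proof.
move=> gq; have := theta_weight gq.
have -> : (l.-1)%:R = - 1 :> fps K.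
  apply/eqP; rewrite -subr_eq0 opprK -(natrD _ _ 1) addn1 prednK; last lia.
  by apply/eqP/pchar_fps.
move=> E; apply: (mulfI nu_n0).
transitivity (evx g * (nu * (P - 3 * xi * nu + 2 * nu))
  + nu ^+ 2 * (3 * xi - 2) * evx g); first ring.
rewrite -Hnu.
transitivity (- 6 * (-1 * evx g * theta nu) + nu ^+ 2 * (3 * xi - 2) * evx g).
  by ring.
by rewrite E !evE; ring.
Qed.

(** Substituting the expression of E2 into its Riccati equation yields, after
    division by the powers of nu, a polynomial identity in xi; injectivity of
    the evaluation removes xi. *)
Lemma hasse_ode0 g : evx g * nu ^+ l.-1 = 1 -> hasse_ode g = 0.
Proof.
move=> gq; have E1 := hasse_P gq.
set b := 6 * (L * g^`()) + (3 * 'X - 2) * g in E1.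
have := congr1 (@theta K) E1; rewrite !thetaM !theta_evL => E2.
suff : evx (12 * (L * (b^`() * g - b * g^`())) + b ^+ 2 - (6 * 'X - 4) * b * g + 'X * g ^+ 2) = 0.
  rewrite -(rmorph0 evx) => /(ev_inj xi0 xi1) H.
  (* The Riccati equation carries the factor X - 1 more than needed. *)
  have : ('X - 1) * hasse_ode g = 0.
    rewrite -[RHS]H /b /hasse_ode.
    have -> : (6 * (L * g^`()) + (3 * 'X - 2) * g)^`() =
       6 * ((2 * 'X - 1) * g^`() + L * g^`()^`()) + 3 * g + (3 * 'X - 2) * g^`().
      rewrite derivD !derivM !derivB derivX derivC !derivM derivX.
      have dn k : (k%:R : {poly K})^`() = 0 by rewrite -(rmorph_nat (@polyC K)) derivC.
      by rewrite !dn; ring.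
    by ring.
  by move/eqP; rewrite mulf_eq0 -(rmorph1 (@polyC K)) polyXsubC_eq0 => /eqP.
clearbody b; apply: (mulfI (expf_neq0 2 nu_n0)); rewrite mulr0.
have Eb : evx b * nu = P * evx g by rewrite E1 mulrC.
rewrite !evE.
move: E2; rewrite !evE; move: (evx g) (evx b) (evx g^`()) (evx b^`()) Eb => G B G' B' Eb E2.
have {}E2 : 12 * theta P * G ^+ 2 + 12 * (P * G) * (nu * (xi * (xi - 1) * G')) =
    2 * (6 * theta nu) * B * G + 12 * nu * G * (nu * (xi * (xi - 1) * B')).
  transitivity (12 * G * (theta P * G + P * (nu * (xi * (xi - 1) * G')))); first ring.
  rewrite E2; ring.
rewrite HP Hnu -Eb in E2.
have E3 : (P ^+ 2 - xi * nu ^+ 2) * G ^+ 2 = (B * nu) ^+ 2 - xi * nu ^+ 2 * G ^+ 2.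
  by rewrite Eb; ring.
have E4 : 2 * (nu * (P - 3 * xi * nu + 2 * nu)) * B * G =
   2 * nu * B * (B * nu - 3 * xi * nu * G + 2 * nu * G) by rewrite Eb; ring.
rewrite E3 E4 in E2; move/eqP: E2; rewrite -subr_eq0 => /eqP E2.
rewrite -[RHS]oppr0 -E2; ring.
Qed.

Section Root.
Variable a : {poly K}.
Hypothesis aq : evx a * nu ^+ n = 1.

Lemma sqrt_hasse_P : P = evx (hasse_b a) * nu ^+ n.+1.
Proof.
have gq : evx (a ^+ 2) * nu ^+ l.-1 = 1.
  by rewrite evE ln -muln2 /= exprM -exprMn aq expr1n.
have := hasse_P gq.
have -> : 6 * (L * (a ^+ 2)^`()) + (3 * 'X - 2) * a ^+ 2 = a * hasse_b a.
  by rewrite expr2 derivM /hasse_b; ring.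
rewrite !evE expr2 => E; apply: (mulIf (ev_unit_neq0 aq)).
transitivity (P * (evx a * evx a) * nu ^+ n).
  by rewrite -[LHS]mulr1 -aq; ring.
rewrite E exprS; ring.
Qed.

Lemma theta_nu_sqrt : theta nu = 2 * (nu ^+ n.+2 * evx (L * a^`())).
Proof.
have E := theta_weight aq.
have n2 : 2 * n%:R = - 1 :> fps K.
  apply/eqP; rewrite -subr_eq0 opprK -natrM -(natrD _ _ 1) mul2n addn1 -ln.
  by apply/eqP/pchar_fps.
rewrite -[LHS]mul1r -{1}aq.
transitivity (- (2 * n%:R) * evx a * theta nu * nu ^+ n); first by rewrite n2; ring.
transitivity (- 2 * (n%:R * evx a * theta nu) * nu ^+ n); first ring.
rewrite E !exprS. ring.
Qed.

Lemma theta_wtheta i g : theta (evx g * nu ^+ i) = evx (wtheta a i g) * nu ^+ (i + n.+1).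
Proof.
rewrite thetaM theta_evL thetaX theta_nu_sqrt.
have -> : wtheta a i g = a * (L * g^`()) + 2 * i%:R * (L * a^`()) * g.
  by rewrite /wtheta natrM; ring.
rewrite evD [evx (a * _)]evM [evx (_ * g)]evM [evx (2 * i%:R * _)]evM.
rewrite [evx (2 * _)]evM !evn.
transitivity (evx a * nu ^+ n * (nu * evx (L * g^`()) * nu ^+ i) +
  evx g * (i%:R * nu ^+ i.-1 * (2 * (nu ^+ n.+2 * evx (L * a^`()))))).
  by rewrite aq mul1r.
by case: i => [|i] /=; rewrite exprD !exprS; ring.
Qed.

Lemma iter_theta_wtheta i g j :
  iter j (@theta K) (evx g * nu ^+ i) = evx (iter_wtheta n a i g j) * nu ^+ (i + j * n.+1).
Proof.
elim: j => [|j IH]; first by rewrite mul0n addn0.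
by rewrite iterS IH theta_wtheta mulSn addnAC addnA.
Qed.
End Root.
End Hasse.

Section HasseInvariant.
Variables (K : closedFieldType) (l n : nat).
Hypothesis l_char : l \in [pchar K].
Hypothesis l_gt3 : (3 < l)%N.
Hypothesis ln : l = n.*2.+1.
Variables (P xi nu : fps K).
Hypothesis Hxi : theta xi = nu * xi * (xi - 1).
Hypothesis Hnu : 6 * theta nu = nu * (P - 3 * xi * nu + 2 * nu).
Hypothesis HP : 12 * theta P = P ^+ 2 - xi * nu ^+ 2.
Hypothesis xi0 : xi 0%N = 1.
Hypothesis nu0 : nu 0%N = 1.
Hypothesis xi1 : xi != 1.

Lemma hasse_sqrt : exists a : {poly K},
  [/\ ev xi a * nu ^+ n = 1, lin_ode a = 0, a.[1] = 1,
      (forall z, z != 0 -> root a z -> mup z a = 1%N) &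
      exists ua va, [/\ (ua <= 1)%N, (va <= 1)%N, (3 * mup 0 a = n + ua)%N
         & (2 * (size a).-1 + va = n)%N]].
Proof.
have gq := hasse_sq_q l_char l_gt3 Hxi Hnu HP xi0 nu0 xi1.
have ode := hasse_ode0 l_char l_gt3 ln Hxi Hnu HP xi0 nu0 xi1 gq.
have sg : (size (hasse_sq K l) <= l)%N by exact: size_hasse_sq.
have g1 : (hasse_sq K l).[1] = 1.
  have := congr1 (fun f : fps K => f 0%N) gq.
  by rewrite coef0_fpsM coef0_fpsX nu0 expr1n mulr1 (ev_coef0 xi0).
have [a [gE a1 smpl [ua ua1 E0] [va va1 E1]]] := ode_sqrt l_char l_gt3 ln sg ode g1.
exists a; split=> //; last by exists ua, va.
  have sq1 : (ev xi a * nu ^+ n) ^+ 2 = 1.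
    by rewrite exprMn -exprM muln2 -evXn -gE -[RHS]gq ln.
  move/eqP: sq1; rewrite sqrf_eq1 => /orP[/eqP //|/eqP E].
  have := congr1 (fun f : fps K => f 0%N) E.
  rewrite coef0_fpsM coef0_fpsX nu0 expr1n mulr1 (ev_coef0 xi0) a1 coef_fpsN coef_fps1 /=.
  move/eqP; rewrite -subr_eq0 opprK -(natrD _ 1 1).
  by rewrite (negbTE (pow23_neq0 l_char l_gt3 1 0)).
have a0 : a != 0 by apply/eqP => a0; move/eqP: a1; rewrite a0 horner0 eq_sym oner_eq0.
move: ode; rewrite gE hasse_ode_sqr => /eqP.
by rewrite mulf_eq0 expf_eq0 (negbTE a0) => /eqP.
Qed.
End HasseInvariant.

(** * Independence of the powers of a root *)

Section Independence.
Variables (K : closedFieldType) (S : idomainType) (phi : {rmorphism {poly K} -> S}).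
Hypothesis phi_inj : injective phi.
Variables (n : nat) (a : {poly K}) (z : K) (mu : S).
Hypothesis mu_unit : mu \is a GRing.unit.
Hypothesis mun : mu ^+ n = phi a.
Hypothesis az : mup z a = 1%N.
Hypothesis a0 : a != 0.

(** The roots of X^n - mu^n are the multiples of mu by the n-th roots of
    unity. *)
Lemma Xn_sub_scale : (0 < n)%N -> exists zs : seq K,
  [/\ 0 \notin zs, size zs = n &
    'X^n - (mu ^+ n)%:P = \prod_(x <- zs) ('X - (phi x%:P * mu)%:P)].
Proof.
move=> n0; have [zs E] := closed_field_poly_normal ('X^n - 1 : {poly K}).
have mon : 'X^n - 1 \is @monic K by rewrite -(rmorph1 (@polyC K)) monicXnsubC.
rewrite (monicP mon) scale1r in E; exists zs.
have sz : size zs = n.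
  by apply: succn_inj; rewrite -(size_prod_XsubC zs id) -E -(rmorph1 (@polyC K)) size_XnsubC.
split=> //.
  rewrite -root_prod_XsubC -E /root !hornerE expr0n (gtn_eqF n0) sub0r oppr_eq0.
  exact: oner_neq0.
pose sc : {poly S} -> {poly S} := fun p => p \Po ((mu^-1)%:P * 'X).
have /(congr1 (fun p : {poly K} => sc (map_poly (phi \o @polyC K) p))) := E.
rewrite rmorphB rmorph1 /= map_polyXn rmorph_prod /= /sc.
rewrite rmorphB rmorph1 /= rmorphXn /= comp_polyX.
rewrite rmorph_prod /= => E'.
have mm : mu * mu^-1 = 1 by rewrite mulrV.
transitivity ((mu ^+ n)%:P * (((mu^-1)%:P * 'X) ^+ n - 1)).
  rewrite mulrBr mulr1 exprMn mulrA -rmorphXn -rmorphM.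
  by rewrite -exprMn mm expr1n rmorph1 mul1r.
rewrite E' rmorphXn /= -sz; elim: (zs) => [|x r IH]; first by rewrite !big_nil mulr1.
rewrite !big_cons exprS mulrACA IH; congr (_ * _).
rewrite map_polyXsubC /= rmorphB /= comp_polyX comp_polyC.
rewrite mulrBr mulrA -!rmorphM /= mm rmorph1.
by rewrite mul1r [mu * _]mulrC.
Qed.

(** A dependence gives a common factor d of positive degree e < n with
    T^n - a. Over S the factor d splits into factors T - x mu with x in K, so
    its constant term is a nonzero constant times mu^e times its leading
    coefficient. The n-th power of this equality takes place in K[X], where
    the multiplicity at the simple zero z of a shows that n divides e. *)
Lemma root_independent (h : nat -> {poly K}) :
  \sum_(j < n) phi (h j) * mu ^+ j = 0 -> forall j, (j < n)%N -> h j = 0.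
Proof.
move=> h0 j0 j0n; apply/eqP; apply: contraT => hj0.
have n0 : (0 < n)%N by apply: leq_trans j0n.
pose p : {poly {poly K}} := \poly_(j < n) h j.
have p0 : p != 0.
  apply: contraNneq hj0 => /(congr1 (fun r : {poly {poly K}} => r`_j0)).
  by rewrite coef_poly j0n coef0 => ->.
pose q : {poly {poly K}} := 'X^n - a%:P.
have q0 : q != 0 by rewrite monic_neq0 // monicXnsubC.
pose E (r : {poly {poly K}}) := (map_poly phi r).[mu].
have Ep : E p = 0.
  rewrite /E /p -[RHS]h0 poly_def rmorph_sum horner_sum; apply: eq_bigr => j _.
  by rewrite /= linearZ /= map_polyXn hornerZ hornerXn.
have Eq : E q = 0.
  by rewrite /E /q rmorphB /= map_polyXn map_polyC /= !hornerE mun subrr.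
pose d := gcdp p q.
have d0 : d != 0 by rewrite gcdp_eq0 negb_and p0.
have sd1 : (1 < size d)%N.
  rewrite -resultant_eq0; apply/eqP.
  case: (leqP (size p) 1) => [/size1_polyC pC|sp].
    move: Ep; rewrite /E pC map_polyC hornerC /= -(rmorph0 phi) => /phi_inj p00.
    by move: p0; rewrite pC p00 eqxx.
  have sq : (1 < size q)%N by rewrite size_XnsubC.
  have [[u v] _ /= R] := resultant_in_ideal sp sq.
  apply: phi_inj; rewrite rmorph0.
  have := congr1 E R; rewrite /E map_polyC hornerC rmorphD !rmorphM hornerD !hornerM.
  by rewrite -/(E p) -/(E q) Ep Eq !mulr0 addr0.
have sdn : (size d <= n)%N.
  by apply: leq_trans (dvdp_leq p0 (dvdp_gcdl _ _)) (size_poly _ _).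
have /Pdiv.Idomain.dvdpP[[c r] /= c0 cE] := dvdp_gcdr p q; rewrite -/d in cE.
have [zs [zs0 szs XE]] := Xn_sub_scale n0.
have phi0 (f : {poly K}) : (phi f == 0) = (f == 0).
  by apply/eqP/eqP => [|->]; rewrite ?rmorph0 // -(rmorph0 phi) => /phi_inj.
have sd' : size (map_poly phi d) = size d.
  by rewrite size_map_poly_id0 // phi0 lead_coef_eq0.
have dvd : map_poly phi d %| \prod_(x <- zs) ('X - (phi x%:P * mu)%:P).
  apply/Pdiv.Idomain.dvdpP; exists (phi c, map_poly phi r) => /=; first by rewrite phi0.
  rewrite -XE mun -[RHS]rmorphM -cE /= map_polyZ /=.
  by rewrite rmorphB /= map_polyXn map_polyC.
have [m /eqpP[[c1 c2] /= /andP[c10 c20] dE]] := dvdp_prod_XsubC dvd.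
set ms := mask m zs in dE.
have e_size : size ms = (size d).-1.
  have := congr1 (fun f : {poly S} => size f) dE; rewrite !size_scale // sd' size_prod_XsubC.
  by move=> ->.
pose e := size ms.
have e0 : (0 < e < n)%N by rewrite /e e_size; move: sd1 sdn; case: (size d) => // k /=; lia.
have ms0 : 0 \notin ms by apply: contra zs0; apply: mem_mask.
pose kap : K := \prod_(x <- ms) - x.
have kap0 : kap != 0.
  rewrite prodf_seq_neq0; apply/allP => x xms; rewrite oppr_eq0.
  by apply: contraNneq ms0 => <-.
have lcE : c1 * phi (lead_coef d) = c2.
  have := congr1 (fun f : {poly S} => lead_coef f) dE.
  rewrite !lead_coefZ lead_coef_prod_XsubC mulr1 => <-.
  by rewrite lead_coef_map_id0 ?rmorph0 // phi0 lead_coef_eq0.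
have cstE : c1 * phi d`_0 = c2 * (phi kap%:P * mu ^+ e).
  have := congr1 (fun f : {poly S} => f.[0]) dE; rewrite !hornerZ horner_coef0 coef_map /= => ->.
  congr (_ * _); rewrite horner_prod /kap /e; elim: (ms) => [|x s IH].
    by rewrite !big_nil rmorph1 mul1r.
  rewrite !big_cons IH /= exprS hornerXsubC sub0r rmorphM rmorphM rmorphN rmorphN /=; ring.
have E1 : phi d`_0 = phi (lead_coef d) * (phi kap%:P * mu ^+ e).
  by apply: (mulfI c10); rewrite cstE -lcE mulrA.
have E2 : d`_0 ^+ n = (lead_coef d) ^+ n * (kap ^+ n)%:P * a ^+ e.
  apply: phi_inj; rewrite rmorphXn E1 !exprMn -exprM mulnC exprM mun !rmorphM !rmorphXn /=.
  by rewrite mulrA.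
have mupX z' f k : f != 0 -> mup z' (f ^+ k) = (k * mup z' f)%N :> nat.
  move=> f0; elim: k => [|k IH].
    by rewrite expr0 mul0n mupNroot // root1.
  by rewrite exprS mupM // ?expf_neq0 // IH mulSn.
have ld0 : lead_coef d != 0 by rewrite lead_coef_eq0.
have kn0 : (kap ^+ n)%:P != 0 by rewrite polyC_eq0 expf_neq0.
have d00 : d`_0 != 0.
  have := mulf_neq0 (mulf_neq0 (expf_neq0 n ld0) kn0) (expf_neq0 e a0).
  apply: contraTneq => d00.
  by rewrite -E2 d00 expr0n (gtn_eqF n0) eqxx.
have kapm : mup z (kap ^+ n)%:P = 0%N by rewrite mupNroot // rootC expf_neq0.
have := congr1 (mup z) E2; rewrite mupX // mupM ?mulf_neq0 ?expf_neq0 // mupM ?expf_neq0 //.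
rewrite !mupX // az kapm addn0 muln1 => E3.
have : (n %| e)%N.
  by rewrite -(@dvdn_addr (n * mup z (lead_coef d))) ?dvdn_mulr // -E3 dvdn_mulr.
by case/andP: e0 => e0 en /dvdn_leq => /(_ e0); rewrite leqNgt en.
Qed.
End Independence.

(** * The coordinates nu and xi *)

Section Coordinates.
Variable K : fieldType.
Variables P Q R : fps K.
Hypothesis HP : 12 * theta P = P ^+ 2 - Q.
Hypothesis HQ : 3 * theta Q = P * Q - R.
Hypothesis HR : 2 * theta R = P * R - Q ^+ 2.
Hypothesis Q0 : Q 0%N = 1.
Hypothesis R0 : R 0%N = 1.
Hypothesis c6 : 6 != 0 :> K.

Definition coord_nu := R / Q.
Definition coord_xi := Q ^+ 3 / R ^+ 2.
Local Notation xi := coord_xi.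
Local Notation nu := coord_nu.

Lemma fps_unit1 (f : fps K) : f 0%N = 1 -> f \is a GRing.unit.
Proof. by move=> f0; rewrite unfold_in /= /fps_unit f0 unitr1. Qed.

Lemma fps_neq0 (f : fps K) : f 0%N = 1 -> f != 0.
Proof. by move=> f0; apply: contraTneq (oner_neq0 K) => e; rewrite -f0 e eqxx. Qed.

Let uQ := fps_unit1 Q0.
Let uR := fps_unit1 R0.
Let nQ := fps_neq0 Q0.
Let nR := fps_neq0 R0.

Lemma nuQ : nu * Q = R. Proof. by rewrite /nu mulrVK. Qed.
Lemma xiR : xi * R ^+ 2 = Q ^+ 3. Proof. by rewrite /xi mulrVK // unitrX. Qed.

Lemma coordQ : Q = xi * nu ^+ 2.
Proof.
apply: (mulIf (expf_neq0 2 nR)); transitivity (Q * (nu * Q) ^+ 2); first by rewrite nuQ.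
by rewrite [RHS]mulrAC xiR; ring.
Qed.

Lemma coordR : R = xi * nu ^+ 3.
Proof. by rewrite -[LHS]nuQ {1}coordQ; ring. Qed.

Lemma coef0_inv (f g : fps K) : f 0%N = 1 -> (g * f) 0%N = 1 -> g 0%N = 1.
Proof. by move=> f0; rewrite coef0_fpsM f0 mulr1. Qed.

Lemma nu_coef0 : nu 0%N = 1.
Proof. by apply: (coef0_inv Q0); rewrite nuQ. Qed.

Lemma xi_coef0 : xi 0%N = 1.
Proof.
apply: (@coef0_inv (R ^+ 2)); first by rewrite coef0_fpsX R0 expr1n.
by rewrite xiR coef0_fpsX Q0 expr1n.
Qed.

Lemma fps_nat_neq0 k : k%:R != 0 :> K -> k%:R != 0 :> fps K.
Proof. by move=> k0; rewrite -(rmorph_nat (@fpsC K)) fmorph_eq0. Qed.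

Lemma theta_xi : theta xi = nu * xi * (xi - 1).
Proof.
have n6 := fps_nat_neq0 c6; have E := congr1 (@theta K) xiR.
rewrite thetaM !thetaX /= in E.
apply: (mulIf (expf_neq0 2 nR)).
have -> : theta xi * R ^+ 2 = Q ^+ 2 * (3 * theta Q) - xi * R * (2 * theta R).
  by apply: (addIr (xi * (2 * R ^+ 1 * theta R))); rewrite E expr1; ring.
rewrite HQ HR.
transitivity (P * Q ^+ 3 - Q ^+ 2 * R - P * (xi * R ^+ 2) + xi * R * Q ^+ 2).
  by ring.
transitivity (nu * Q ^+ 3 * (xi - 1)); last by rewrite -xiR; ring.
transitivity (Q ^+ 2 * R * (xi - 1)); first by rewrite xiR; ring.
by rewrite -[X in _ * X * _ = _]nuQ; ring.
Qed.

Lemma theta_nu6 : 6 * theta nu = nu * (P - 3 * xi * nu + 2 * nu).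
Proof.
have E := congr1 (@theta K) nuQ; rewrite thetaM in E.
apply: (mulIf nQ).
transitivity (3 * (2 * theta R) - 2 * nu * (3 * theta Q)).
  by rewrite -E; ring.
rewrite HQ HR; move: coordQ nuQ; move: xi nu => x v EQ ER.
transitivity (v * Q * P - 3 * (Q * Q) + 2 * v ^+ 2 * Q); first by rewrite -ER; ring.
by rewrite {2}EQ; ring.
Qed.

Lemma theta_P12 : 12 * theta P = P ^+ 2 - xi * nu ^+ 2.
Proof. by rewrite HP -coordQ. Qed.

(** E4^3 - E6^2 starts with 1728 q. *)
Lemma xi_neq1 : Q 1%N = 240 -> R 1%N = - 504 -> xi != 1.
Proof.
move=> Q1 R1; apply/eqP => x1; have := xiR; rewrite x1 mul1r.
have c1M (f g : fps K) : (f * g) 1%N = f 0%N * g 1%N + f 1%N * g 0%N.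
  by rewrite coef_fpsM big_ord_recl big_ord1.
rewrite (exprS Q) !expr2 => /fpsP /(_ 1%N); rewrite !(c1M, coef0_fpsM) Q0 R0 Q1 R1 => E.
have : 6 ^+ 3 * (2 ^+ 3) = 0 :> K.
  transitivity ((1 * (1 * 240 + 240 * 1) + 240 * (1 * 1)) - (1 * - 504 + - 504 * 1) : K); first ring.
  by rewrite -E subrr.
have c2 : 2 != 0 :> K.
  have e6 : 6 = 2 * 3 :> K by ring.
  by apply: contraNneq c6 => c2; rewrite e6 c2 mul0r.
by apply/eqP; rewrite mulf_neq0 // expf_neq0.
Qed.
End Coordinates.

(** * Simple congruences as differential relations *)

Section Congruence.
Variables (K : fieldType) (l : nat).
Hypothesis l_char : l \in [pchar K].

Lemma natr_eq_mod M N : M%:R = N%:R :> K -> M = N %[mod l].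
Proof.
wlog MN : M N / (M <= N)%N.
  by move=> H; case: (leqP M N) => [/H //|/ltnW NM /esym /(H _ _ NM)].
move/esym/eqP; rewrite -subr_eq0 -natrB // -(dvdn_pcharf l_char) -eqn_mod_dvd //.
by move/eqP.
Qed.

Lemma theta_iterM_const (f u : fps K) j : theta u = 0 ->
  iter j (@theta K) (f * u) = iter j (@theta K) f * u.
Proof. by move=> u0; elim: j => [|j IH] //=; rewrite IH thetaM u0 mulr0 addr0. Qed.

Lemma theta_expl (u : fps K) k : theta (u ^+ (l * k)) = 0.
Proof.
rewrite thetaX natrM -(rmorph_nat (@fpsC K) l) (pcharf0 l_char) rmorph0.
by rewrite !mul0r.
Qed.

(** With x = N / c, the coefficient of index N is multiplied by the sum of x^j
    over 1 <= j < l; as x^l = x, that sum vanishes unless x = 1. *)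
Lemma congruence_theta (f : fps K) c : c%:R != 0 :> K ->
    (forall N, N = c %[mod l] -> f N = 0) ->
  \sum_(1 <= j < l) fpsC (c%:R^-1 ^+ j) * iter j (@theta K) f = 0.
Proof.
move=> c0 fc; apply/fpsP => N; rewrite coef_fps_sum.
pose x : K := N%:R / c%:R.
transitivity (f N * \sum_(1 <= j < l) x ^+ j).
  rewrite mulr_sumr; apply: eq_bigr => j _.
  by rewrite coef_fpsCM coef_iter_theta /x exprMn; ring.
have l1 : (1 < l)%N := prime_gt1 (pcharf_prime l_char).
have xl : x ^+ l = x by rewrite /x exprMn exprVn !(frobenius_natr l_char).
case: (eqVneq x 1) => [x1|x1].
  by rewrite fc ?mul0r //; apply: natr_eq_mod; rewrite -[LHS](divfK c0) -/x x1 mul1r.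
suff -> : \sum_(1 <= j < l) x ^+ j = 0 by rewrite mulr0.
apply: (mulfI (_ : x - 1 != 0)); first by rewrite subr_eq0.
rewrite mulr0; have := subrX1 x l; rewrite -(big_mkord xpredT) big_ltn; last by lia.
by rewrite xl expr0 mulrDr mulr1 => /(canLR (addKr _)) <-; ring.
Qed.

(** The constant term of f is 1, so the class of the congruence is not 0. *)
Lemma simple_congruence_nat (f : fps int) : simple_congruence f l -> (f 0%N)%:~R = 1 :> K ->
  exists2 c : nat, c%:R != 0 :> K & forall N, N = c %[mod l] -> (f N)%:~R = 0 :> K.
Proof.
case=> c fc f0; have l0 : (0 < l)%N := prime_gt0 (pcharf_prime l_char).
have lz : l%:Z != 0 by lia.
pose c0 := `|(c %% l%:Z)%Z|%N.
have c0E : (c0 : int) = (c %% l%:Z)%Z by rewrite /c0 gez0_abs // modz_ge0.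
have fN N : N = c0 %[mod l] -> (f N)%:~R = 0 :> K.
  move=> Nc; have [q Nq] : exists q : int, N%:Z = l%:Z * q + c.
    have : (N%:Z = c %[mod l%:Z])%Z.
      by rewrite modz_nat Nc -modz_nat c0E modz_mod.
    move/eqP; rewrite eqz_mod_dvd => /dvdzP[q Eq]; exists q.
    by rewrite mulrC -Eq subrK.
  have := fc q; rewrite -Nq /= mod0z => /dvdz_mod0P/dvdzP[q' ->].
  by rewrite intrM /= -pmulrn (pcharf0 l_char) mulr0.
exists c0 => //; rewrite -(dvdn_pcharf l_char); apply/negP => /eqP lc.
by have /eqP := fN 0%N (etrans (mod0n l) (esym lc)); rewrite f0 oner_eq0.
Qed.
End Congruence.

(** Pairs the indices that are equal modulo n, in decreasing order of the
    first. *)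
Lemma sum_halves (V : zmodType) (T : nat -> V) n :
  \sum_(1 <= j < n.*2.+1) T j = \sum_(m < n) (T (n - m)%N + T (n - m + n)%N).
Proof.
rewrite big_add1 /= -addnn big_mkord big_split_ord /= big_split /=.
congr (_ + _); rewrite (reindex_inj rev_ord_inj) /=; apply: eq_bigr => m _.
  by rewrite subnSK.
by rewrite -addnS subnSK // addnC.
Qed.

(** * Separating the weights *)

Section Relation.
Variables (K : closedFieldType) (n : nat) (xi nu : fps K) (a : {poly K}) (z : K).
Hypothesis n0 : (0 < n)%N.
Hypothesis xi0 : xi 0%N = 1.
Hypothesis xi1 : xi != 1.
Hypothesis nu0 : nu 0%N = 1.
Hypothesis aq : ev xi a * nu ^+ n = 1.
Hypothesis az : mup z a = 1%N.
Hypothesis a0 : a != 0.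

(** Multiplied by a large power of mu = 1 / nu, the j-th term involves a power
    of mu whose residue modulo n is that of -j, because mu^n = a(xi). By
    independence the terms with indices j and j + n cancel; the pair with
    j = 1 is the claim. *)
Lemma weight_separation (G : nat -> {poly K}) (x : K) i : x != 0 ->
    \sum_(1 <= j < n.*2.+1) fpsC (x ^+ j) * (ev xi (G j) * nu ^+ (i + j * n.+1)) = 0 ->
  G n.+1 = (- (x ^+ n)^-1)%:P * a ^+ n.+1 * G 1%N.
Proof.
move=> x0 sum0; have nu_u : nu \is a GRing.unit := fps_unit1 nu0.
pose mu := nu^-1; have mu_u : mu \is a GRing.unit by rewrite unitrV.
have nm : nu * mu = 1 by rewrite mulrV.
have mun : mu ^+ n = ev xi a.
  by rewrite -[LHS]mul1r -aq -mulrA -exprMn nm expr1n mulr1.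
pose h m : {poly K} := (x ^+ (n - m))%:P * a ^+ m *
  (a ^+ n.+1 * G (n - m)%N + (x ^+ n)%:P * G (n - m + n)%N).
have numu A B : (B <= A)%N -> nu ^+ B * mu ^+ A = mu ^+ (A - B).
  by move=> BA; rewrite -{1}(subnKC BA) exprD mulrA -exprMn nm expr1n mul1r.
have h0 : \sum_(m < n) ev xi (h m) * mu ^+ m = 0.
  have := congr1 (fun f => f * mu ^+ (i + n.*2 * n.+1)) sum0; rewrite mul0r mulr_suml.
  rewrite sum_halves => S0; rewrite -[RHS]S0; apply: eq_bigr => m _; have mn := ltn_ord m.
  have E1 : nu ^+ (i + (n - m) * n.+1) * mu ^+ (i + n.*2 * n.+1) =
      ev xi a ^+ (m + n.+1) * mu ^+ m.
    by rewrite numu -?mun -?exprM -?exprD; [congr (_ ^+ _)|]; nia.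
  have E2 : nu ^+ (i + (n - m + n) * n.+1) * mu ^+ (i + n.*2 * n.+1) =
      ev xi a ^+ m * mu ^+ m.
    by rewrite numu -?mun -?exprM -?exprD; [congr (_ ^+ _)|]; nia.
  rewrite -!mulrA E1 E2 /h !evE !evC !exprD !rmorphM; ring.
have ev_inj' : injective (ev xi : {rmorphism _ -> _}) by exact: ev_inj.
have nn : (n.-1 < n)%N by rewrite prednK.
have := root_independent ev_inj' mu_u mun az a0 h0 nn.
rewrite /h (_ : n - n.-1 = 1)%N; last by lia.
move/eqP; rewrite expr1 add1n !mulf_eq0 polyC_eq0 (negbTE x0) expf_eq0 (negbTE a0) andbF /=.
rewrite addrC addr_eq0 => /eqP E; have xn0 : x ^+ n != 0 by rewrite expf_neq0.
have xc0 : (x ^+ n)%:P != 0 by rewrite polyC_eq0.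
apply: (mulfI xc0); rewrite E polyCN !mulNr mulrN !mulrA -polyCM mulfV // polyC1 mul1r.
by [].
Qed.
End Relation.

(** * The relation forces trivial exponents *)

Definition lift_exp (l : nat) (s : int) : nat :=
  match s with Posz m => m | Negz m => (l - m.+1)%N end.
Definition is_neg (s : int) : bool := if s is Negz _ then true else false.

Lemma lift_expE l s : (`|s| <= l)%N -> (lift_exp l s : int) = s + (l * is_neg s)%:Z.
Proof. by case: s => m /= sl; lia. Qed.

Section Exponents.
Variables (K : closedFieldType) (l n : nat).
Hypothesis l_char : l \in [pchar K].
Hypothesis l_gt3 : (3 < l)%N.
Hypothesis ln : l = n.*2.+1.
Variable a : {poly K}.
Hypothesis ode : lin_ode a = 0.
Hypothesis a1 : a.[1] = 1.
Hypothesis smpl : forall z, z != 0 -> root a z -> mup z a = 1%N.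
Variables ua va : nat.
Hypothesis ua1 : (ua <= 1)%N.
Hypothesis va1 : (va <= 1)%N.
Hypothesis a_mup0 : (3 * mup 0 a = n + ua)%N.
Hypothesis a_size : (2 * (size a).-1 + va = n)%N.

Lemma hasse_neq0 : a != 0.
Proof. by apply/eqP => a0; move/eqP: a1; rewrite a0 horner0 eq_sym oner_eq0. Qed.

(** The simple zeros away from 0 are counted by the degree and the order at
    0. *)
Lemma hasse_roots : exists rs : seq K,
  [/\ uniq rs, 0 \notin rs, (6 * size rs + 3 * va + 2 * ua = n)%N &
      forall z, z \in rs -> [/\ z != 0, z != 1 &
        exists2 b : {poly K}, b.[z] != 0 & a = ('X - z%:P) * b]].
Proof.
have a0 := hasse_neq0; have [za aE] := closed_field_poly_normal a.
have lc0 : lead_coef a != 0 by rewrite lead_coef_eq0.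
have mu z : mup z a = count_mem z za.
  by rewrite aE -mul_polyC mupMr ?rootC // mu_prod_XsubC.
have rza z : root a z = (z \in za).
  by rewrite aE rootZ // root_prod_XsubC.
exists [seq z <- za | z != 0]; split.
- apply: count_mem_uniq => z; rewrite mem_filter count_filter.
  case: (eqVneq z 0) => [->|z0] /=.
    by rewrite (eq_count (a2 := pred0)) ?count_pred0 // => x /=; case: eqP.
  rewrite (eq_count (a2 := pred1 z)); last by move=> x /=; case: eqP => [->|].
  case: (boolP (z \in za)) => zza; last by apply/count_memPn.
  by rewrite -mu smpl // rza.
- by rewrite mem_filter eqxx.
- have E : size za = (size a).-1 by rewrite aE size_scale // size_prod_XsubC.
  have := count_predC (pred1 0) za; rewrite -mu E size_filter.
  have -> : count (predC (pred1 0)) za = count (fun z => z != 0) za by [].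
  by move: a_mup0 a_size; move: (mup 0 a) (size a).-1 (count _ _) => m d N; lia.
move=> z; rewrite mem_filter => /andP[z0 zza]; split=> //.
  apply: contraTneq zza => ->; rewrite -rza /root a1; exact: oner_neq0.
have [b bz E] := mupP z a0; rewrite smpl // ?rza // expr1 in E.
by exists b.
Qed.

Variables (r : nat) (s t : int).
Hypothesis bound : (r + 4 * `|s| + 6 * `|t| + 11 <= n)%N.
Let s' := lift_exp l s.
Let t' := lift_exp l t.
Let i0 := (r * n.+1 + 2 * s' + 3 * t')%N.
Let k : int := r%:Z + 4 * s + 6 * t.
Let G0 := hasse_b a ^+ r * 'X^(s' + t').
Variable c : K.
Hypothesis c0 : c != 0.
Hypothesis rel : iter_wtheta n a i0 G0 n.+1 = c%:P * a ^+ n.+1 * iter_wtheta n a i0 G0 1.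

(** A form of weight l - 1 divisible by E4^ua E6^va, as the order at 0 and the
    degree show. *)
Lemma hasse_supp : supp n ua va a.
Proof.
move=> p ap; have pd : (p <= (size a).-1)%N.
  rewrite -ltnS prednK ?size_poly_gt0 ?hasse_neq0 //.
  by apply: contraNT ap; rewrite -leqNgt => /leq_sizeP ->.
have mp : (mup 0 a <= p)%N.
  rewrite leqNgt; apply: contraNN ap => pm; have [q _ qE] := mupP 0 hasse_neq0.
  by rewrite qE subr0 mulrC coefMXn pm.
by move: a_mup0 a_size; lia.
Qed.

(** Replacing s and t by their lifts changes the weight by multiples of l, and
    2 (n + 1) = l + 1. *)
Lemma weight_mod : (2 * i0)%:R = k%:~R :> K.
Proof.
have -> : k = (2 * i0)%:Z - (l * (r + 4 * is_neg s + 6 * is_neg t))%:Z.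
  have := @lift_expE l s; have := @lift_expE l t; rewrite -/s' -/t' /i0 /k ln.
  by move: bound; case: (is_neg s); case: (is_neg t); lia.
by rewrite rmorphB /= -!pmulrn (natrM _ l) (pcharf0 l_char) mul0r subr0.
Qed.

(** The sign of the weight k decides: for k > 0 one zero of a suffices for a
    contradiction, for k = 0 two zeros determine the exponents, and for k < 0
    the zeros of the iterate of index 1 - k are counted. *)
Lemma relation_trivial : [/\ r = 0%N, s = 0 & t = 0].
Proof.
have [rs [urs rs0 rs_size rsP]] := hasse_roots.
have Nge1 : (0 < size rs)%N by move: rs_size bound; lia.
have i0k := weight_mod.
case: (ltrP 0 k) => [k_gt0|k_le0].
  pose z := nth 0 rs 0; have zrs : z \in rs by apply: mem_nth.
  have [z0 z1 [b bz aE]] := rsP z zrs.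
  case: (relation_pos l_char l_gt3 ln z0 z1 aE bz (k := `|k|%N) rel).
  - exact: (has_order_monomial l_char l_gt3 z0 z1 aE bz).
  - by move: k_gt0; lia.
  - by move: bound k_gt0; rewrite /k ln; lia.
  by rewrite i0k pmulrn; congr _%:~R; move: k_gt0; lia.
(* The index at which the weight is 1 modulo l, just after the only place
   where the order can change. *)
pose J := `|k|.+1; have J0 : (0 < J <= n.+1)%N by move: bound k_le0; rewrite /J /k; lia.
have iJ : (2 * i0 + J)%:R = 1 :> K.
  rewrite natrD i0k pmulrn -rmorphD /= (_ : k + J%:Z = 1) //.
  by move: k_le0; rewrite /J; lia.
have dvdJ z : z \in rs -> ('X - z%:P) ^+ n.+1 %| iter_wtheta n a i0 G0 J.
  move=> zrs; have [z0 z1 [b bz aE]] := rsP z zrs.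
  exact: (relation_neg l_char l_gt3 ln z0 z1 aE bz rel J0 iJ).
case: (eqVneq k 0) => [k0|kn0].
  case: (boolP ((s == 0) && (t == 0))) => [/andP[/eqP s0 /eqP t0]|st].
    by split=> //; move: k0; rewrite /k s0 t0; lia.
  exfalso.
  have N2 : (1 < size rs)%N by move: rs_size bound st; lia.
  have zero z : z \in rs -> r%:R * (3 * z - 2) + 12 * (s' + t')%:R * (z - 1) = 0.
    move=> zrs; have [z0 z1 [b bz aE]] := rsP z zrs.
    apply: (relation_zero l_char l_gt3 ln z0 z1 aE bz rel) => //; first by lia.
    by rewrite i0k k0.
  pose z1 := nth 0 rs 0; pose z2 := nth 0 rs 1.
  have E1 : r%:R * (3 * z1 - 2) + 12 * (s' + t')%:R * (z1 - 1) = 0.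
    by apply: zero; apply: mem_nth.
  have E2 : r%:R * (3 * z2 - 2) + 12 * (s' + t')%:R * (z2 - 1) = 0.
    by apply: zero; apply: mem_nth.
  have z12 : z1 - z2 != 0 by rewrite subr_eq0 nth_uniq.
  (* The equation is affine in z and has two solutions, so both its coefficients
     vanish. *)
  have E3 : 3 * r%:R + 12 * (s' + t')%:R = 0 :> K.
    apply: (mulfI z12); rewrite mulr0.
    transitivity ((r%:R * (3 * z1 - 2) + 12 * (s' + t')%:R * (z1 - 1)) -
      (r%:R * (3 * z2 - 2) + 12 * (s' + t')%:R * (z2 - 1))); first ring.
    by rewrite E1 E2 subrr.
  have E4 : r%:R = 0 :> K.
    transitivity ((3 * r%:R + 12 * (s' + t')%:R) * (1 - z1)
      + (r%:R * (3 * z1 - 2) + 12 * (s' + t')%:R * (z1 - 1))); first ring.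
    by rewrite E3 E1 mul0r addr0.
  have r0 : r = 0%N.
    move/eqP: E4; rewrite (natr_pchar_eq0 l_char) => /dvdnP[q].
    by case: q => [|q]; rewrite ?mul0n //; move: bound; nia.
  have E5 : (s' + t')%:R = 0 :> K.
    move: E3; rewrite r0 mulr0 add0r => /eqP; rewrite mulf_eq0.
    by rewrite (negbTE (pow23_neq0 l_char l_gt3 2 1)) => /eqP.
  have E6 : (s + t)%:~R = 0 :> K.
    have -> : s + t = (s' + t')%:Z - (l * (is_neg s + is_neg t))%:Z.
      have := @lift_expE l s; have := @lift_expE l t; rewrite -/s' -/t' ln.
      by move: bound; case: (is_neg s); case: (is_neg t); lia.
    by rewrite rmorphB /= -!pmulrn E5 (natrM _ l) (pcharf0 l_char) mul0r subr0.
  have st0 : s + t = 0.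
    have : (absz (s + t)%R)%:R = 0 :> K.
      case: (s + t) E6 => m; rewrite ?NegzE ?rmorphN /= -pmulrn //.
      by move/eqP; rewrite oppr_eq0 => /eqP.
    move/eqP; rewrite (natr_pchar_eq0 l_char) => /dvdnP[q].
    by case: q => [|q]; [|move: bound; rewrite ln]; nia.
  by move: k0 st st0; rewrite /k r0; lia.
exfalso.
(* The first iterate has order 0 at z because k is not 0 modulo l; if the
   iterate of index J vanished, so would that of index n + 1, against the
   relation. *)
have GJ : iter_wtheta n a i0 G0 J != 0.
  pose z := nth 0 rs 0; have zrs : z \in rs by apply: mem_nth.
  have [z0 z1 [b bz aE]] := rsP z zrs.
  have G1 : iter_wtheta n a i0 G0 1 != 0.
    apply: (@has_order_neq0 _ z 0).
    apply: (iter_wtheta_order l_char l_gt3 ln z0 z1 aE bz (j := 0)) => //.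
      exact: (has_order_monomial l_char l_gt3 z0 z1 aE bz).
    move=> j j0; rewrite -(natr_pchar_eq0 l_char) (_ : 0 + (2 * i0 + j) = 2 * i0)%N; last by lia.
    rewrite i0k (_ : k = - (`|k|%N)%:Z); last by move: k_le0; lia.
    rewrite rmorphN oppr_eq0 /= -pmulrn (natr_pchar_eq0 l_char).
    by apply/negP => /dvdn_leq; move: bound kn0 k_le0; rewrite /k ln; lia.
  apply: contraNneq G1 => GJ0.
  have Jn : (J <= n.+1)%N by case/andP: J0.
  have /eqP := iter_wtheta0 Jn GJ0; rewrite rel !mulf_eq0 expf_eq0 polyC_eq0.
  by rewrite (negbTE hasse_neq0) (negbTE c0) andbF.
pose U := if ua == 1%N then s' else 0%N; pose V := if va == 1%N then t' else 0%N.
have sG0 : supp i0 U V G0.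
  have sb : supp n.+1 0 0 (hasse_b a).
    rewrite (hasse_bE l_char ln); by apply: suppW (supp_serre hasse_supp).
  have := suppM (@suppX _ _ _ _ _ r sb) (@supp_Xn K s' t').
  rewrite !mul0n !add0n addnA mulnC => S.
  by apply: suppW S; rewrite /U /V; case: eqP.
have sGJ : supp (i0 + J * n.+1) U V (iter_wtheta n a i0 G0 J).
  apply: (supp_iter_wtheta l_char l_gt3 ln hasse_supp _ _ sG0); rewrite /U /V.
    by case: eqP; [left|right].
  by case: eqP; [left|right].
(* The number of zeros is (n - 3 va - 2 ua) / 6, each of order n + 1; the rest
   is arithmetic, in which the bound on n decides. *)
have := supp_count sGJ GJ urs rs0 dvdJ.
have H := leq_mul bound (leqnn n.+1).
have HN : ((6 * size rs + 3 * va + 2 * ua) * n.+1 = n * n.+1)%N by rewrite rs_size.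
have HJ : (J%:Z + (r%:Z + 4 * s + 6 * t)) * n.+1%:Z = n.+1%:Z.
  by rewrite (_ : J%:Z + _ = 1) ?mul1r // /J; move: k_le0; rewrite /k; lia.
rewrite /U /V /i0 /s' /t'; move: (size rs) (J) HN HJ H => N j.
have ua01 : ua = 0%N \/ ua = 1%N by move: ua1; lia.
have va01 : va = 0%N \/ va = 1%N by move: va1; lia.
move: bound; rewrite ln; case: ua01 => ->; case: va01 => -> /=.
all: case: (s) => s1; case: (t) => t1 /=; clear; nia.
Qed.
End Exponents.

(** * Reduction modulo l *)

Section Reduction.
Variables (K : closedFieldType) (l n : nat).
Hypothesis l_char : l \in [pchar K].
Hypothesis l_gt3 : (3 < l)%N.
Hypothesis ln : l = n.*2.+1.

Local Notation M := (map_fps (intmul 1 : {rmorphism int -> K})).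

(** An l-th power of the series makes up for a negative exponent. *)
Lemma map_fps_lift (u : fps int) s : u 0%N = 1 -> (`|s| <= l)%N ->
  M (u ^ s) * M u ^+ (l * is_neg s) = M u ^+ lift_exp l s.
Proof.
move=> u0 sl; have uu : u \is a GRing.unit by rewrite unfold_in /= /fps_unit u0 unitr1.
have Mu : M u \is a GRing.unit := rmorph_unit _ uu.
case: s sl => m ml /=; first by rewrite muln0 expr0 mulr1 rmorphXn.
rewrite muln1 -[u ^ _]/((u ^+ m.+1)^-1) rmorphV ?unitrX // rmorphXn.
by rewrite -{1}(subnK (ml : (m.+1 <= l)%N)) exprD mulrCA mulVr ?mulr1 ?unitrX.
Qed.

(** The multiplier U is a product of l-th powers, hence a constant for theta,
    so the relation of the congruence holds for the lifted monomial too. *)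
Lemma congruence_relation (r : nat) (s t : int) :
    simple_congruence (E2 ^ r%:Z * E4 ^ s * E6 ^ t) l ->
    (r + 4 * `|s| + 6 * `|t| + 11 <= n)%N ->
  [/\ r = 0%N, s = 0 & t = 0].
Proof.
move=> cong bound.
have [O2 O4 O6] := ramanujan_ode.
pose P := M E2; pose Q := M E4; pose R := M E6.
have HP : 12 * theta P = P ^+ 2 - Q.
  by rewrite -map_theta -(rmorph_nat M) -rmorphM O2 rmorphB rmorphXn.
have HQ : 3 * theta Q = P * Q - R.
  by rewrite -map_theta -(rmorph_nat M) -rmorphM O4 rmorphB rmorphM.
have HR : 2 * theta R = P * R - Q ^+ 2.
  by rewrite -map_theta -(rmorph_nat M) -rmorphM O6 rmorphB rmorphM rmorphXn.
have P0 : P 0%N = 1 by [].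
have Q0 : Q 0%N = 1 by [].
have R0 : R 0%N = 1 by [].
have c6 : 6 != 0 :> K := pow23_neq0 l_char l_gt3 1 1.
have sig1 k : sigma k 1 = 1%N by rewrite /sigma big_seq1 exp1n.
have Q1 : Q 1%N = 240 by rewrite /Q /= sig1.
have R1 : R 1%N = - 504 by rewrite /R /= sig1.
pose xi := coord_xi Q R; pose nu := coord_nu Q R.
have Hxi : theta xi = nu * xi * (xi - 1) := theta_xi HQ HR Q0 R0 c6.
have Hnu : 6 * theta nu = nu * (P - 3 * xi * nu + 2 * nu) := theta_nu6 HQ HR Q0 R0.
have HPx : 12 * theta P = P ^+ 2 - xi * nu ^+ 2 := theta_P12 HP Q0 R0.
have xi0 : xi 0%N = 1 := xi_coef0 Q0 R0.
have nu0 : nu 0%N = 1 := nu_coef0 Q0 R0.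
have xi1 : xi != 1 := xi_neq1 Q0 R0 c6 Q1 R1.
have [a [aq ode a1 smpl [ua [va [ua1 va1 E0 E1]]]]] :=
  hasse_sqrt l_char l_gt3 ln Hxi Hnu HPx xi0 nu0 xi1.
have a0 := hasse_neq0 a1.
have [rs [_ _ rs_size rsP]] := hasse_roots l_char l_gt3 ln a1 smpl ua1 va1 E0 E1.
have zrs : nth 0 rs 0 \in rs.
  by apply: mem_nth; move: bound rs_size ua1 va1; case: (size rs) => //; lia.
have [z0 _ [b bz aE]] := rsP _ zrs.
have az : mup (nth 0 rs 0) a = 1%N.
  by apply: smpl => //; rewrite aE rootM root_XsubC eqxx.
pose F := E2 ^ r%:Z * E4 ^ s * E6 ^ t.
pose U := Q ^+ (l * is_neg s) * R ^+ (l * is_neg t).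
pose s' := lift_exp l s; pose t' := lift_exp l t.
have sl : (`|s| <= l)%N by rewrite ln; move: bound; lia.
have tl : (`|t| <= l)%N by rewrite ln; move: bound; lia.
have FU : M F * U = P ^+ r * Q ^+ s' * R ^+ t'.
  rewrite -[P ^+ r](rmorphXn M) -(map_fps_lift (u := E4)) // -(map_fps_lift (u := E6)) //.
  by rewrite /F !rmorphM /U; ring.
have thetaU : theta U = 0.
  by rewrite /U thetaM !(theta_expl l_char) mul0r mulr0 addr0.
have F0 : (F 0%N)%:~R = 1 :> K.
  rewrite -[LHS]/(M F 0%N); move: (M F) FU => f /(congr1 (fun f : fps K => f 0%N)).
  by rewrite /U !coef0_fpsM !coef0_fpsX P0 Q0 R0 !expr1n !mulr1.
have [c c0 Fc] := simple_congruence_nat l_char cong F0.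
have sum0 := congruence_theta (f := M F) l_char c0 Fc.
pose i0 := (r * n.+1 + 2 * s' + 3 * t')%N.
pose G0 : {poly K} := hasse_b a ^+ r * 'X^(s' + t').
have PE := sqrt_hasse_P l_char l_gt3 ln Hxi Hnu nu0 xi1 aq.
have QE : Q = xi * nu ^+ 2 := coordQ Q0 R0.
have RE : R = xi * nu ^+ 3 := coordR Q0 R0.
have monomial (e x v : fps K) : (e * v ^+ n.+1) ^+ r * (x * v ^+ 2) ^+ s' *
    (x * v ^+ 3) ^+ t' = e ^+ r * x ^+ (s' + t') * v ^+ i0.
  by rewrite !exprMn -!exprM [(n.+1 * r)%N]mulnC !exprD; ring.
have FG : M F * U = ev xi G0 * nu ^+ i0.
  by rewrite /G0 evM !evXn evX -monomial FU -PE -QE -RE.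
pose G := iter_wtheta n a i0 G0.
have sumG : \sum_(1 <= j < n.*2.+1) fpsC (c%:R^-1 ^+ j) *
    (ev xi (G j) * nu ^+ (i0 + j * n.+1)) = 0.
  rewrite -ln -[RHS](mul0r U) -[X in _ = X * U]sum0 mulr_suml; apply: eq_bigr => j _.
  rewrite -mulrA -(theta_iterM_const _ _ thetaU); congr (_ * _).
  by rewrite -[X in iter j _ X]/(M F * U) FG (iter_theta_wtheta l_char ln Hxi nu0 aq).
have x0 : c%:R^-1 != 0 :> K by rewrite invr_eq0.
have n0 : (0 < n)%N by move: bound; lia.
have rel := weight_separation n0 xi0 xi1 nu0 aq az a0 x0 sumG.
apply: (relation_trivial l_char l_gt3 ln ode a1 smpl ua1 va1 E0 E1 bound _ rel).
by rewrite oppr_eq0 invr_eq0 expf_neq0.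
Qed.
End Reduction.

Theorem theorem1p1 (r s t : int) (l : nat) (r_ge0 : 0 <= r) (l_prime : prime l)
    (l_cong : simple_congruence (E2 ^ r * E4 ^ s * E6 ^ t) l) :
  l%:Z <= 2 * r + 8 * `|s| + 12 * `|t| + 21 \/ [/\ r = 0, s = 0 & t = 0].
Proof.
case: lerP => [_|bound]; [by left | right].
case: r r_ge0 l_cong bound => // r _ l_cong bound.
have l_gt3 : (3 < l)%N by lia.
have l_odd : odd l by case: (even_prime l_prime) => // l2; move: l_gt3; rewrite l2.
have [K [FtoK _]] := countable_algebraic_closure 'F_l.
have l_char : l \in [pchar K].
  by rewrite (fmorph_pchar FtoK) pchar_Fp.
have ln : l = l./2.*2.+1 by rewrite -[LHS]odd_double_half l_odd.
have [->] : [/\ r = 0%N, s = 0 & t = 0].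
  apply: (congruence_relation l_char l_gt3 ln l_cong).
  by move: bound ln; lia.
by [].
Qed.
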